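(* Let $P$ be an Eulerian Sheffer poset whose binomial factorial function satisfies $B(0)=1$ and $B(n) = 2^{n-1}$ for $n \geq 1$, and let $C(n)$ be its coatom function. Then every Sheffer $n$-interval $[\hat 0, y]$ of $P$ factors as a rank product $$[\hat 0,y] \cong \bigl(T_{n-2} \cup \{\hat 0, \widehat{-1}\}\bigr) * Q,$$ where $T_{n-2}\cup\{\hat0,\widehat{-1}\}$ is the butterfly poset $T_{n-2}$ with two new minimal elements attached in order (a new element $\hat 0$ below a new element $\widehat{-1}$, which lies below all of $T_{n-2}$), and $Q$ is a poset of rank $n$ such that: (i) each element of rank $2$ through $n-1$ in $Q$ is covered by exactly one element; (ii) each element of rank $1$ in $Q$ is covered by exactly two elements; (iii) each element of even rank $4$ through $2\lfloor n/2\rfloor$ in $Q$ covers exactly one element; (iv) each element of odd rank $k$ from $5$ through $2\lfloor n/2\rfloor+1$ in $Q$ covers exactly $C(k)/2$ elements; (v) each $3$-interval $[\hat 0, x]$ in $Q$ is isomorphic to a poset of the form $P_{q_1,\ldots,q_r}$ with $q_1+\cdots+q_r = C(3)$.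
   Context: All posets are locally finite with a unique minimal element $\hat 0$. A Sheffer poset is such a poset $P$ that (i) contains an infinite chain, (ii) has every interval graded (rank function $\rho$, $\rho(\hat0)=0$; $[x,y]$ is an $n$-interval if $\rho(y)-\rho(x)=n$), (iii) any two $n$-intervals $[\hat0,y]$, $[\hat0,v]$ with $y,v\neq\hat0$ have the same number $D(n)$ of maximal chains, and (iv) any two $n$-intervals $[x,y]$, $[u,v]$ with $x,u\neq\hat0$ have the same number $B(n)$ of maximal chains. Intervals $[\hat0,y]$ are Sheffer intervals. The coatom function is $C(n)=D(n)/D(n-1)$. A poset is Eulerian if $\mu(x,y)=(-1)^{\rho(y)-\rho(x)}$ for all $x\le y$. The butterfly poset $T_m$ is the graded poset of rank $m$ with a minimum, a maximum, and exactly two elements of each rank $1,\dots,m-1$, every element of rank $k$ lying below every element of rank $k+1$. The rank product of ranked posets $P,Q$ is $P*Q=\{(x,z)\in P\times Q : \rho_P(x)=\rho_Q(z)\}$ with $(x,y)\le(z,w)$ iff $x\le_P z$ and $y\le_Q w$. For $q\ge2$, $P_q$ is the face poset (including empty face and the whole polygon) of a $q$-gon; for $q_1,\ldots,q_r\ge 2$, $P_{q_1,\ldots,q_r}$ is obtained from $P_{q_1},\ldots,P_{q_r}$ by identifying all minimal elements and identifying all maximal elements.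
   Formalization: The theorem is stated for n ≥ 2, so that T_{n-2} is defined, and condition (ii) is claimed only for n ≥ 3: when n = 2, Q is isomorphic to [0̂, y], and each rank-1 element is covered by only the top element, so (ii) is false there. *)

(* Defs.v *)
From HB Require Import structures.
From mathcomp Require Import all_boot all_order all_algebra.
From mathcomp Require Import boolp classical_sets functions.
From mathcomp Require Import cardinality fsbigop.

Set Implicit Arguments.
Unset Strict Implicit.
Unset Printing Implicit Defensive.

Import Order.TTheory GRing.Theory Num.Theory.

Local Open Scope classical_set_scope.
Local Open Scope card_scope.
Local Open Scope order_scope.

(** Chains, gradedness and rank *)

Section Chains.
Context {d : Order.disp_t} {T : porderType d}.
Implicit Types (x y : T) (s t : seq T).

Definition locally_finite := forall x y, finite_set [set` `[x, y]].

(* A finite chain is represented by the list of its elements, sorted in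
   strictly increasing order; this representation is unique. *)
Definition chains x y : set (seq T) :=
  [set s | sorted <%O s /\ {subset s <= `[x, y]}].

Definition maximal_chains x y : set (seq T) :=
  [set s | chains x y s /\
           forall t, chains x y t -> {subset s <= t} -> s = t].

Definition graded_interval x y :=
  forall s t, maximal_chains x y s -> maximal_chains x y t -> size s = size t.

End Chains.

Arguments locally_finite {d} T.

(* The length of a maximal chain of [\bot, x]; independent of the chain that is
   picked as soon as [\bot, x] is graded. *)
Definition rank {d} {T : bPOrderType d} (x : T) : nat :=
  (size (xget [::] (maximal_chains \bot x))).-1.

(** Sheffer posets *)

(* All the n-intervals considered have the same number of maximal chains: this
   common number is D n for the intervals [\bot, y] with y != \bot, and B n for
   the intervals [x, y] with x != \bot. The value D 0 is irrelevant. *)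
Record sheffer {d} (P : bPOrderType d) (D B : nat -> nat) : Prop := {
  sheffer_locally_finite : locally_finite P ;
  sheffer_infinite_chain :
    exists2 A : set P, infinite_set A & total_on A (fun x y => x <= y) ;
  sheffer_graded : forall x y : P, x <= y -> graded_interval x y ;
  sheffer_D : forall y : P, y != \bot ->
    maximal_chains \bot y #= `I_(D (rank y)) ;
  sheffer_B : forall x y : P, x != \bot -> x <= y ->
    maximal_chains x y #= `I_(B (rank y - rank x)%N) }.

(* A rational number, so that the quotients C(n) and C(n) / 2 are exact. *)
Definition coatom_function (D : nat -> nat) (n : nat) : rat :=
  ((D n)%:R / (D n.-1)%:R)%R.

(** Eulerian posets *)

(* This determines mu x y for all x <= y in a locally finite poset; the values
   at the other pairs are never used. *)
Definition moebius_function {d} {T : porderType d} (mu : T -> T -> int) :=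
  (forall x, mu x x = 1%R) /\
  (forall x y, x < y -> (\sum_(z \in [set` `[x, y]]) mu x z = 0)%R).

Definition eulerian {d} (P : bPOrderType d) :=
  exists2 mu : P -> P -> int, moebius_function mu &
    forall x y, x <= y -> mu x y = ((-1) ^+ (rank y - rank x)%N)%R.

(** Isomorphisms and rank products *)

Definition order_isomorphic {d d'} {S : porderType d} {T : porderType d'}
    (A : set S) (B : set T) :=
  exists2 f : S -> T, set_bij A B f &
    {in A &, forall x y, (f x <= f y) = (x <= y)}.

(* The ambient type S *p T carries the componentwise order. *)
Definition rank_product {d d'} (S : bPOrderType d) (T : bPOrderType d') :
  set (S *p T) := [set p | rank p.1 = rank p.2].

Arguments rank_product {d d'} S T.

(** Adjunction of a new least or greatest element *)

Definition with_bottom (T : Type) := option T.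

HB.instance Definition _ (T : choiceType) := Choice.on (with_bottom T).

Section WithBottom.
Context {d : Order.disp_t} {T : porderType d}.

Definition with_bottom_le (u v : with_bottom T) :=
  match u, v with
  | None, _ => true
  | Some _, None => false
  | Some x, Some y => x <= y
  end.

Fact with_bottom_le_refl : reflexive with_bottom_le.
Proof. by case=> [x|] /=. Qed.

Fact with_bottom_le_anti : antisymmetric with_bottom_le.
Proof. by move=> [x|] [y|] //= /le_anti ->. Qed.

Fact with_bottom_le_trans : transitive with_bottom_le.
Proof. by move=> [y|] [x|] [z|] //=; apply: le_trans. Qed.

HB.instance Definition _ := @Order.Le_isPOrder.Build d (with_bottom T)
  with_bottom_le with_bottom_le_refl with_bottom_le_anti with_bottom_le_trans.

Fact with_bottom_le0x (u : with_bottom T) : (None : with_bottom T) <= u.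
Proof. by []. Qed.

HB.instance Definition _ :=
  @Order.hasBottom.Build d (with_bottom T) None with_bottom_le0x.

End WithBottom.

Definition with_top (T : Type) := option T.

HB.instance Definition _ (T : choiceType) := Choice.on (with_top T).

Section WithTop.
Context {d : Order.disp_t} {T : porderType d}.

Definition with_top_le (u v : with_top T) :=
  match u, v with
  | _, None => true
  | None, Some _ => false
  | Some x, Some y => x <= y
  end.

Fact with_top_le_refl : reflexive with_top_le.
Proof. by case=> [x|] /=. Qed.

Fact with_top_le_anti : antisymmetric with_top_le.
Proof. by move=> [x|] [y|] //= /le_anti ->. Qed.

Fact with_top_le_trans : transitive with_top_le.
Proof. by move=> [y|] [x|] [z|] //=; apply: le_trans. Qed.

HB.instance Definition _ := @Order.Le_isPOrder.Build d (with_top T)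
  with_top_le with_top_le_refl with_top_le_anti with_top_le_trans.

End WithTop.

(** Butterfly posets *)

(* (k, b) is an element of rank k; both values of b are allowed exactly when
   0 < k < m. *)
Definition butterfly (m : nat) :=
  {p : 'I_m.+1 * bool | (0 < p.1 < m)%N || ~~ p.2}.

HB.instance Definition _ m := [Finite of butterfly m by <:].

Section Butterfly.
Variable m : nat.

Definition butterfly_le (u v : butterfly m) :=
  (u == v) || ((val u).1 < (val v).1)%N.

Fact butterfly_le_refl : reflexive butterfly_le.
Proof. by move=> u; rewrite /butterfly_le eqxx. Qed.

Fact butterfly_le_anti : antisymmetric butterfly_le.
Proof.
move=> u v /andP[/orP[/eqP //|uv] /orP[/eqP //|vu]].
by have := ltn_trans uv vu; rewrite ltnn.
Qed.

Fact butterfly_le_trans : transitive butterfly_le.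
Proof.
move=> v u w /orP[/eqP -> //|uv] /orP[/eqP <-|vw].
  by rewrite /butterfly_le uv orbT.
by rewrite /butterfly_le (ltn_trans uv vw) orbT.
Qed.

HB.instance Definition _ :=
  @Order.Le_isPOrder.Build (Order.Disp tt tt) (butterfly m)
    butterfly_le butterfly_le_refl butterfly_le_anti butterfly_le_trans.

End Butterfly.

(** Face posets of polygons *)

(* The vertices (i, false) and the edges (i, true) of a q-gon; the edge i joins
   the vertices i and i + 1 modulo q. *)
Definition polygon_face (q : nat) := ('I_q * bool)%type.

Definition polygon_face_le q (u v : polygon_face q) :=
  (u == v) ||
  [&& ~~ u.2, v.2 & (u.1 == v.1) || (u.1 == ordS v.1)].

(* The nonempty proper faces of disjoint polygons with qs_0, qs_1, ... edges. *)
Definition polygon_faces (qs : seq nat) :=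
  {i : 'I_(size qs) & polygon_face (nth 0%N qs i)}.

HB.instance Definition _ qs := Finite.on (polygon_faces qs).

Section PolygonFaces.
Variable qs : seq nat.

Definition polygon_faces_le (u v : polygon_faces qs) :=
  (tag u == tag v) && polygon_face_le (tagged u) (tagged_as u v).

Fact polygon_faces_le_refl : reflexive polygon_faces_le.
Proof.
by case=> i u; rewrite /polygon_faces_le tagged_asE /polygon_face_le !eqxx.
Qed.

Fact polygon_faces_le_anti : antisymmetric polygon_faces_le.
Proof.
move=> [i u] [j v] /andP[]; rewrite /polygon_faces_le /=.
case/andP=> /eqP ij; case: j / ij v => v; rewrite !tagged_asE /= eqxx /=.
case/orP=> [/eqP -> //|/and3P[_ v2 _]] /orP[/eqP -> //|/and3P[Nv2 _ _]].
by rewrite v2 in Nv2.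
Qed.

Fact polygon_faces_le_trans : transitive polygon_faces_le.
Proof.
move=> [j v] [i u] [k w]; rewrite /polygon_faces_le /=.
case/andP=> /eqP ij; case: j / ij v => v; rewrite tagged_asE /= => uv.
case/andP=> /eqP ik; case: k / ik w => w; rewrite !tagged_asE /= eqxx /=.
case/orP: uv => [/eqP -> //|uv] /orP[/eqP <-|/and3P[Nv2 _ _]].
  by rewrite /polygon_face_le uv orbT.
by case/and3P: uv => _ v2 _; rewrite v2 in Nv2.
Qed.

HB.instance Definition _ :=
  @Order.Le_isPOrder.Build (Order.Disp tt tt) (polygon_faces qs)
    polygon_faces_le polygon_faces_le_refl polygon_faces_le_anti
    polygon_faces_le_trans.

End PolygonFaces.

(* The poset P_(q_1, ..., q_r): after the identifications there remain a single
   empty face, a single maximal face, and the disjoint union of the other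
   faces. *)
Definition polygons (qs : seq nat) := with_bottom (with_top (polygon_faces qs)).

HB.instance Definition _ qs := Order.BPOrder.on (polygons qs).

(** Cover relations in finite posets *)

Section Covers.
Context {d : Order.disp_t} {Q : finPOrderType d}.

Definition covers (y x : Q) := (x < y) && [forall z, ~~ (x < z < y)].

Definition upper_covers (x : Q) : {set Q} := [set y | covers y x]%SET.
Definition lower_covers (x : Q) : {set Q} := [set y | covers x y]%SET.

End Covers.

(* Main.v *)
(* Above a non-bottom element every interval is a butterfly, because B(n) = 2^(n-1)
   forces exactly two atoms and two coatoms in each interval of length at least 2.
   Pairing ranks 2j-1 and 2j in the Euler relation of an initial interval of even
   rank leaves two coatoms there as well. Hence two elements of equal rank k,
   3 <= k < n, lying above a common atom have the same elements strictly below and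
   the same elements strictly above them in [0, y]: call them twins. Every element
   of such a rank has exactly one twin, and Q is obtained by keeping one element of
   each pair, the butterfly coordinate remembering which one was dropped. In rank 3
   the incidences between ranks 1 and 2 form a 2-regular graph, that is, a disjoint
   union of polygons. *)
From HB Require Import structures.
Require Import Defs.
From mathcomp Require Import all_boot all_order all_algebra.
From mathcomp Require Import boolp classical_sets functions cardinality fsbigop.
From mathcomp Require Import zify.

Set Implicit Arguments.
Unset Strict Implicit.
Unset Printing Implicit Defensive.

Import Order.TTheory GRing.Theory Num.Theory.

Local Open Scope classical_set_scope.
Local Open Scope card_scope.
Local Open Scope order_scope.

(** * Maximal chains and rank functions *)

Section Saturated.
Context {d : Order.disp_t} {T : porderType d}.
Implicit Types (x y z u v w : T) (s t : seq T).

(** The delicate point is the lower side of twins. Above a common atom the order is dictated by rank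
    alone, but an element of odd rank k has C(k) coatoms, a number that [B] does not determine, and
    nothing forces all of them to lie over that atom. The sets below two twins of odd rank are
    therefore compared from above, through a common upper cover of even rank. Twins begin at rank 3
    because two elements of rank 2 over one atom may have different second atoms; rank 3 is also
    where a butterfly raised by two ranks can first have two elements. Since [rank] reads off the
    length of an arbitrarily picked maximal chain, each poset involved (P, the interval, the
    bottomed butterfly, Q) is given a function satisfying the chain-free [rank_function], which
    determines [rank] once it vanishes at the bottom. *)

Definition cov : rel T := fun x y => `[< x < y /\ forall z, ~ (x < z < y) >].

Lemma covP x y : reflect (x < y /\ forall z, ~ (x < z < y)) (cov x y).
Proof. exact: asboolP. Qed.

Lemma cov_lt x y : cov x y -> x < y.
Proof. by case/covP. Qed.

Definition saturated x s y := path cov x s && (last x s == y).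

Lemma saturated_cons x z s y :
  saturated x (z :: s) y = cov x z && saturated z s y.
Proof. by rewrite /saturated /= andbA. Qed.

Lemma saturated_rcons x z s y :
  saturated x (rcons s z) y = [&& saturated x s (last x s), cov (last x s) z & z == y].
Proof. by rewrite /saturated rcons_path last_rcons eqxx andbT andbA. Qed.

Lemma saturated_cat x y z s t :
  saturated x s y -> saturated y t z -> saturated x (s ++ t) z.
Proof.
move=> /andP[xs /eqP <-] /andP[yt /eqP <-].
by rewrite /saturated cat_path xs yt last_cat eqxx.
Qed.

Lemma path_cov_lt x s : path cov x s -> path <%O x s.
Proof. exact/sub_path/cov_lt. Qed.

Lemma path_lt_last x s z : path <%O x s -> z \in x :: s -> x <= z <= last x s.
Proof.
elim: s x z => [|y s IH] x z /=; first by rewrite inE => _ /eqP ->; rewrite lexx.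
case/andP=> xy ys; rewrite inE => /orP[/eqP ->|/(IH _ _ ys)/andP[yz ->]].
  have /andP[_ /(le_trans (ltW xy)) ->] := IH y y ys (mem_head _ _).
  by rewrite lexx.
by rewrite (le_trans (ltW xy) yz).
Qed.

Lemma saturated_le x s y : saturated x s y -> x <= y.
Proof.
by case/andP=> /path_cov_lt xs /eqP <-; have /andP[] := path_lt_last xs (mem_head _ _).
Qed.

Lemma sorted_lt_comparable s u v : sorted <%O s -> u \in s -> v \in s -> u >=< v.
Proof.
case: s => //= x s; elim: s x u v => [|y s IH] x u v /=.
  by move=> _; rewrite !inE => /eqP-> /eqP->; rewrite comparablexx.
case/andP=> xy ys; have xs z : z \in y :: s -> x <= z.
  by case/(path_lt_last ys)/andP=> + _; apply: le_trans (ltW xy).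
rewrite inE => /orP[/eqP ->|us]; rewrite inE => /orP[/eqP ->|vs].
- exact: comparablexx.
- exact/le_comparable/xs.
- exact/ge_comparable/xs.
- exact: (IH y).
Qed.

(** Nothing fits strictly between consecutive elements of a saturated chain, so an element
    comparable with all of them has no other place to be. *)
Lemma path_cov_mem x s z : path cov x s -> x <= z <= last x s ->
  (forall w, w \in x :: s -> z >=< w) -> z \in x :: s.
Proof.
elim: s x => [|y s IH] x /=.
  by move=> _ xz _; rewrite inE eq_sym eq_le xz.
case/andP=> /covP[xy xyN] ys /andP[xz zl] zC.
rewrite inE; case: eqVneq => //= zx; apply: IH => // [|w ws]; last first.
  by apply: zC; rewrite inE ws orbT.
rewrite zl andbT; have zy : z >=< y by apply: zC; rewrite !inE eqxx orbT.
case: (comparable_ltP zy) => // {}zy; case: (xyN z); rewrite zy andbT lt_neqAle xz.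
by rewrite eq_sym zx.
Qed.

Lemma mem_path_cov x s : path <%O x s ->
  (forall z, x <= z <= last x s -> (forall w, w \in x :: s -> z >=< w) ->
     z \in x :: s) -> path cov x s.
Proof.
elim: s x => [|y s IH] x //= /andP[xy ys] H.
have yl w : w \in y :: s -> y <= w by case/(path_lt_last ys)/andP.
have yle := yl _ (mem_last y s).
apply/andP; split.
  apply/covP; split=> // z /andP[xz zy].
  have : z \in [:: x, y & s].
    apply: H => [|w]; first by rewrite (ltW xz) (le_trans (ltW zy)).
    rewrite inE => /orP[/eqP ->|/yl/(le_trans (ltW zy))/le_comparable //].
    exact/ge_comparable/ltW.
  rewrite inE (gt_eqF xz) /= => /yl yz.
  by have := lt_le_trans zy yz; rewrite ltxx.
apply: IH => // z /andP[yz zl] zC.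
have xz := lt_le_trans xy yz.
have : z \in [:: x, y & s].
  apply: H => [|w]; first by rewrite (ltW xz).
  by rewrite inE => /orP[/eqP ->|/zC //]; apply/ge_comparable/ltW.
by rewrite inE (gt_eqF xz).
Qed.

(** Otherwise sorting [z :: s] would produce a strictly larger chain. *)
Lemma maximal_chain_mem x y s z : maximal_chains x y s -> x <= z <= y ->
  (forall w, w \in s -> z >=< w) -> z \in s.
Proof.
move=> [[ss sxy] smax] zxy zC; apply: contraT => zs.
have tot : {in z :: s &, total <=%O}.
  move=> u v; rewrite !inE => /orP[/eqP ->|us] /orP[/eqP ->|vs].
  - by rewrite lexx.
  - exact: zC.
  - by rewrite orbC; apply: zC.
  - exact: (sorted_lt_comparable ss).
case/negP: (zs); have -> : s = sort <=%O (z :: s); last by rewrite mem_sort mem_head.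
apply: smax; last by move=> w ws; rewrite mem_sort inE ws orbT.
split; last first.
  by move=> w; rewrite mem_sort inE => /orP[/eqP ->|/sxy //]; rewrite in_itv.
rewrite lt_sorted_uniq_le sort_uniq (sort_sorted_in tot) ?andbT; last first.
  by apply/allP.
by rewrite /= zs lt_sorted_uniq.
Qed.

Lemma maximal_chainsP x y s : x <= y ->
  maximal_chains x y s <-> exists2 t, s = x :: t & saturated x t y.
Proof.
move=> xy; split=> [smax|[t -> {s}]].
  have [[ss sxy] _] := smax.
  have sle w : w \in s -> x <= w <= y by move/sxy; rewrite in_itv.
  have xs : x \in s.
    apply: (maximal_chain_mem smax) => [|w /sle/andP[xw _]]; first by rewrite lexx.
    exact: le_comparable.
  have ys : y \in s.
    apply: (maximal_chain_mem smax) => [|w /sle/andP[_ wy]]; first by rewrite xy lexx.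
    exact: ge_comparable.
  case: s => // z t in smax ss sxy sle xs ys *.
  have {}sx : path <%O z t by [].
  have zx : z = x.
    apply/eqP; rewrite eq_le; have /andP[-> _] := path_lt_last sx xs.
    by have /andP[-> _] := sle _ (mem_head _ _).
  subst z; exists t => //.
  have lxt : last x t = y.
    apply/eqP; rewrite eq_le; have /andP[_ ->] := path_lt_last sx ys.
    by have /andP[_ ->] := sle _ (mem_last _ _).
  rewrite /saturated lxt eqxx andbT; apply: mem_path_cov => // z.
  by rewrite lxt; apply: maximal_chain_mem.
case/andP=> xt /eqP lt.
have sxt := path_cov_lt xt.
split; first split=> //.
  by move=> z /(path_lt_last sxt); rewrite lt in_itv.
move=> s [ss sxy] sub; apply: lt_sorted_eq => // z.
apply/idP/idP => [/sub //|zs]; apply: path_cov_mem => // [|w /sub ws].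
  by rewrite lt; have := sxy _ zs; rewrite in_itv.
exact: (sorted_lt_comparable ss).
Qed.

(** The size of a chain is bounded by that of the finite interval, and a chain of greatest size is
    maximal for inclusion. *)
Lemma exists_maximal_chain x y : finite_set [set` `[x, y]] ->
  exists s, maximal_chains x y s.
Proof.
case/finite_seqP=> e /seteqP[xye _].
pose p k := `[< exists2 s, chains x y s & size s = k >].
have ubp k : p k -> (k <= size e)%N.
  case/asboolP=> s [ss sxy] <-; apply: uniq_leq_size; first exact: lt_sorted_uniq.
  by move=> z /sxy zxy; apply: (xye z).
have p0 : exists k, p k by exists 0; apply/asboolP; exists [::].
have [k /asboolP[s [ss sxy] <- kmax]] := ex_maxnP p0 ubp.
exists s; split=> // t [ts txy] st.
have su := lt_sorted_uniq ss.
have le : (size t <= size s)%N by apply: kmax; apply/asboolP; exists t.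
by apply: lt_sorted_eq => //; have [] := uniq_min_size su st le.
Qed.

Lemma exists_saturated x y : finite_set [set` `[x, y]] -> x <= y ->
  exists s, saturated x s y.
Proof.
by move=> /exists_maximal_chain[s +] xy => /(maximal_chainsP _ xy)[t _ xt]; exists t.
Qed.

Lemma le_rank_lt (r : T -> nat) x y : x <= y -> (r x < r y)%N -> x < y.
Proof.
rewrite lt_neqAle => -> rxy; rewrite andbT.
by apply: contraTneq rxy => ->; rewrite ltnn.
Qed.

(** Strict growth together with the absence of jumps across a cover. Neither clause mentions chains,
    so the property is easily checked on subposets. *)
Definition rank_function (r : T -> nat) :=
  {homo r : x y / x < y >-> (x < y)%N} /\
  forall x y, x < y -> ((r x).+1 < r y)%N -> exists z, x < z < y.

Section RankFunction.
Variables (r : T -> nat) (rP : rank_function r).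

Lemma rank_function_lt x y : x < y -> (r x < r y)%N.
Proof. by move/rP.1. Qed.

Lemma rank_function_le x y : x <= y -> (r x <= r y)%N.
Proof. by rewrite le_eqVlt => /orP[/eqP -> //|/rank_function_lt/ltnW]. Qed.

Lemma rank_function_eq x y : x <= y -> (r y <= r x)%N -> x = y.
Proof.
by rewrite le_eqVlt => /orP[/eqP -> //|/rank_function_lt]; rewrite ltnNge => /negPf ->.
Qed.

Lemma cov_rank x y : cov x y = (x < y) && (r y == (r x).+1).
Proof.
apply/covP/andP => [[xy xyN]|[xy /eqP ryx]]; split=> //.
  rewrite eqn_leq rank_function_lt // andbT leqNgt; apply/negP => /(rP.2 _ _ xy)[z].
  exact: xyN.
by move=> z /andP[/rank_function_lt xz /rank_function_lt]; rewrite ryx ltnS leqNgt xz.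
Qed.

Lemma saturated_rank x s y : saturated x s y -> r y = (r x + size s)%N.
Proof.
elim: s x => [|z s IH] x; first by rewrite addn0 => /eqP /= ->.
by rewrite saturated_cons cov_rank => /andP[/andP[_ /eqP rz] /IH ->]; rewrite rz addSnnS.
Qed.

Lemma rank_function_saturated x y : x <= y -> exists s, saturated x s y.
Proof.
have [k] := ubnP (r y - r x)%N; elim: k x y => // k IH x y; rewrite ltnS => kxy.
rewrite le_eqVlt => /orP[/eqP ->|xy]; first by exists [::]; rewrite /saturated /=.
have rxy := rank_function_lt xy.
have [yx|yx] := leqP (r y) (r x).+1.
  exists [:: y]; rewrite saturated_cons cov_rank xy eqn_leq yx rxy.
  exact: eqxx.
have [z /andP[xz zy]] := rP.2 _ _ xy yx.
have rxz := rank_function_lt xz; have rzy := rank_function_lt zy.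
have [|s xs] := IH x z _ (ltW xz).
  by apply: leq_trans kxy; rewrite ltn_sub2r.
have [|t zt] := IH z y _ (ltW zy).
  by apply: leq_trans kxy; rewrite ltn_sub2l.
by exists (s ++ t); apply: saturated_cat xs zt.
Qed.

Lemma rank_function_interpolate x y k : x <= y -> (r x <= k <= r y)%N ->
  exists2 z, x <= z <= y & r z = k.
Proof.
move=> /rank_function_saturated[s]; elim: s x => [|z s IH] x.
  move=> /eqP /= ->; rewrite -eqn_leq => /eqP <-; by exists y; rewrite ?lexx.
rewrite saturated_cons cov_rank => /andP[/andP[xz /eqP rz] zs] /andP[].
rewrite leq_eqVlt => /orP[/eqP <- _|xk ky].
  by exists x => //; rewrite lexx (le_trans (ltW xz) (saturated_le zs)).
have [|w /andP[zw wy] rw] := IH z zs; first by rewrite rz xk.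
by exists w => //; rewrite wy (le_trans (ltW xz)).
Qed.

Lemma rank_function_graded x y : x <= y -> graded_interval x y.
Proof.
move=> xy s t /(maximal_chainsP _ xy)[s' -> /saturated_rank xs].
by case/(maximal_chainsP _ xy)=> t' -> /saturated_rank; rewrite xs => /addnI /= ->.
Qed.

Lemma exists_cov x y : x < y -> exists2 z, cov x z & z <= y.
Proof.
move=> xy; have [[|z s]] := rank_function_saturated (ltW xy).
  by move=> /eqP /= exy; rewrite exy ltxx in xy.
by rewrite saturated_cons => /andP[xz /saturated_le zy]; exists z.
Qed.

Lemma exists_cov_below x y : x < y -> exists2 z, x <= z & cov z y.
Proof.
move=> xy; have [s] := rank_function_saturated (ltW xy).
case/lastP: s => [/eqP /= exy|s z]; first by rewrite exy ltxx in xy.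
rewrite saturated_rcons => /and3P[/saturated_le xl lz /eqP <-].
by exists (last x s).
Qed.

End RankFunction.

End Saturated.

Lemma saturated_bot_rank {d} {T : bPOrderType d} (x : T) s :
  graded_interval \bot x -> saturated \bot s x -> rank x = size s.
Proof.
move=> gx xs.
have smax : maximal_chains \bot x (\bot :: s) by apply/maximal_chainsP => //; exists s.
by rewrite /rank (gx (xget [::] _) _ (xgetPex [::] (ex_intro _ _ smax)) smax).
Qed.

Lemma rank_function_rank {d} {T : bPOrderType d} (r : T -> nat) :
  rank_function r -> r \bot = 0 -> @rank _ T =1 r.
Proof.
move=> rP r0 x; have [s xs] := rank_function_saturated rP (le0x x).
rewrite (saturated_bot_rank _ xs) ?(saturated_rank rP xs) ?r0 //.
exact: (rank_function_graded rP).
Qed.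

Lemma graded_rank_function {d} {T : bPOrderType d} :
  locally_finite T -> (forall x y : T, x <= y -> graded_interval x y) ->
  rank_function (@rank _ T).
Proof.
move=> Tfin Tgr.
(* A saturated chain from [x] to [y], appended to one from the bottom to [x], is a saturated chain
   that computes the rank of [y]. *)
have rankE (x y : T) s : saturated x s y -> rank y = (rank x + size s)%N.
  move=> xs; have [t bt] := exists_saturated (Tfin \bot x) (le0x x).
  rewrite (saturated_bot_rank (Tgr _ _ (le0x x)) bt) -size_cat.
  by apply: saturated_bot_rank (Tgr _ _ (le0x y)) _; apply: saturated_cat bt xs.
split=> [x y xy|x y xy].
  have [[|z s] xs] := exists_saturated (Tfin x y) (ltW xy).
    by case/eqP: xs xy => /= ->; rewrite ltxx.
  by rewrite (rankE _ _ _ xs) -addSnnS leq_addr.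
have [s xs] := exists_saturated (Tfin x y) (ltW xy).
rewrite (rankE _ _ _ xs) -addn1 ltn_add2l.
case: s xs => [|z [|w s]] //; rewrite !saturated_cons => /and3P[xz zw ws] _.
by exists z; rewrite (cov_lt xz) (lt_le_trans (cov_lt zw) (saturated_le ws)).
Qed.

(** * Counting maximal chains *)

Lemma card_eq_seqP {T : choiceType} (A : set T) n :
  A #= `I_n <-> exists s : seq T, [/\ uniq s, size s = n & A = [set` s]].
Proof.
split=> [An|[s [us <- ->]]].
  exists (finmap.enum_fset (fset_set A)); rewrite finmap.fset_uniq (card_fset_set An).
  split=> //.
  have Afin : finite_set A by exists n.
  by apply/seteqP; split=> x /=; rewrite in_fset_set // in_setE.
have [m sm] : finite_set [set` s] by apply/finite_seqP; exists s.
suff -> : size s = m by [].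
rewrite -(card_fset_set sm); apply: perm_size; apply: uniq_perm => // x.
rewrite in_fset_set; last by exists m.
by apply/idP/idP; rewrite in_setE.
Qed.

(** In the applications [L] lists the atoms or coatoms of an interval, and [p] reads off a chain the
    one through which it passes, so that the fibers are disjoint. *)
Lemma card_eq_fibers {I S S' : choiceType} (L : seq I) (h : I -> S' -> S)
    (p : S -> I) (F : I -> set S') (A : set S) k :
  uniq L -> (forall i, i \in L -> F i #= `I_k) ->
  (forall i t, i \in L -> F i t -> p (h i t) = i) ->
  (forall i, injective (h i)) ->
  (forall s, A s <-> exists i t, [/\ i \in L, F i t & s = h i t]) ->
  A #= `I_(size L * k).
Proof.
move=> uL Fk pK hI AE.
have [f fP] : exists f : I -> seq S', forall i, i \in L ->
    [/\ uniq (f i), size (f i) = k & F i = [set` f i]].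
  have /choice[f fP] : forall i, exists s, i \in L ->
      [/\ uniq s, size s = k & F i = [set` s]].
    move=> i; have [iL|] := boolP (i \in L); last by exists [::].
    by have /card_eq_seqP[s sP] := Fk _ iL; exists s.
  by exists f.
apply/card_eq_seqP; exists [seq h i t | i <- L, t <- f i]; split.
- apply: allpairs_uniq_dep => // [i /fP[] //|].
  move=> _ _ /allpairsPdep[i [t [iL ti ->]]] /allpairsPdep[j [u [jL uj ->]]] /= e.
  have ij : i = j.
    have [_ _ Fi] := fP _ iL; have [_ _ Fj] := fP _ jL.
    by rewrite -(pK i t) ?Fi // e pK // Fj.
  by subst j; rewrite (hI _ _ _ e).
- have {fP} fk i : i \in L -> size (f i) = k by case/fP.
  rewrite size_allpairs_dep; elim: L fk {uL Fk pK AE} => //= i l IH fk.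
  rewrite fk ?mem_head // IH ?mulSn // => j jl.
  by rewrite fk // inE jl orbT.
- apply/seteqP; split=> s.
    case/AE=> i [t [iL Fit ->]]; apply/allpairsPdep; exists i, t; split=> //.
    by move: Fit; have [_ _ ->] := fP _ iL.
  case/allpairsPdep=> i [t [iL it ->]]; apply/AE; exists i, t; split=> //.
  by have [_ _ ->] := fP _ iL.
Qed.

Section CountChains.
Context {d : Order.disp_t} {T : porderType d}.
Implicit Types (x y z : T) (L : seq T).

Lemma card_maximal_chains_cons x y k L : x < y -> uniq L ->
  (forall z, (z \in L) = cov x z && (z <= y)) ->
  (forall z, z \in L -> maximal_chains z y #= `I_k) ->
  maximal_chains x y #= `I_(size L * k).
Proof.
move=> xy uL LE Lk.
pose p (s : seq T) := nth x s 1.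
apply: (@card_eq_fibers _ _ _ L (fun=> cons x) p (fun z => maximal_chains z y)) => //.
- move=> z t; rewrite LE => /andP[_ zy] /(maximal_chainsP _ zy)[t' -> _] //.
- by move=> _ s t [].
move=> s; split=> [/(maximal_chainsP _ (ltW xy))[[|z t] ->]|[z [t [zL + ->]]]].
- by case/eqP=> /= exy; rewrite exy ltxx in xy.
- rewrite saturated_cons => /andP[xz zt]; have zy := saturated_le zt.
  by exists z, (z :: t); rewrite LE xz zy; split=> //; apply/maximal_chainsP => //; exists t.
- move: zL; rewrite LE => /andP[xz zy] /(maximal_chainsP _ zy)[t' -> zt].
  by apply/maximal_chainsP; [exact: ltW | exists (z :: t'); rewrite ?saturated_cons ?xz].
Qed.

Lemma card_maximal_chains_rcons x y k L : x < y -> uniq L ->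
  (forall z, (z \in L) = cov z y && (x <= z)) ->
  (forall z, z \in L -> maximal_chains x z #= `I_k) ->
  maximal_chains x y #= `I_(size L * k).
Proof.
move=> xy uL LE Lk.
(* The element just below [y]: the last one once [y] is removed from the chain. *)
pose p (s : seq T) := last x (take (size s).-1 s).
apply: (@card_eq_fibers _ _ _ L (fun=> rcons^~ y) p (fun z => maximal_chains x z)) => //.
- move=> z t; rewrite LE => /andP[_ xz] /(maximal_chainsP _ xz)[t' -> /andP[_ /eqP tz]].
  by rewrite /p size_rcons -cats1 take_size_cat.
- by move=> _ s t /rcons_inj[].
move=> s; split=> [/(maximal_chainsP _ (ltW xy))[t ->]|[z [t [zL + ->]]]].
  case/lastP: t => [/eqP /= exy|t z]; first by rewrite exy ltxx in xy.
  rewrite saturated_rcons => /and3P[xt tz /eqP zy]; subst z.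
  have xl := saturated_le xt.
  exists (last x t), (x :: t); rewrite LE tz xl; split=> //.
  by apply/maximal_chainsP => //; exists t.
move: zL; rewrite LE => /andP[zy xz] /(maximal_chainsP _ xz)[t' -> xt].
apply/maximal_chainsP; [exact: ltW | exists (rcons t' y) => //].
by case/andP: (xt) => _ /eqP tz; rewrite saturated_rcons tz xt zy eqxx.
Qed.

End CountChains.

(** * Subposets and order isomorphisms *)

Section Subposet.
Context {d : Order.disp_t} {T : porderType d} (s : seq T) (lo hi : T).

(** The proofs are arguments of the type itself, so that bottom and top instances can be attached to
    it. It serves both for the initial interval and for the set of twin representatives. *)
Definition subposet of lo \in s & hi \in s &
  (forall x, x \in s -> lo <= x <= hi) := seq_sub s.

Variables (lo_s : lo \in s) (hi_s : hi \in s)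
  (s_bounds : forall x, x \in s -> lo <= x <= hi).

Notation S := (subposet lo_s hi_s s_bounds).

HB.instance Definition _ := SubChoice.on S.
HB.instance Definition _ := Finite.on S.
HB.instance Definition _ := [SubChoice_isSubPOrder of S by <: with d].

Definition subposet_bot : S := SeqSub lo_s.
Definition subposet_top : S := SeqSub hi_s.

Fact subposet_le0x (x : S) : subposet_bot <= x.
Proof. by rewrite -Order.le_val; have /andP[] := s_bounds (valP x). Qed.

Fact subposet_lex1 (x : S) : x <= subposet_top.
Proof. by rewrite -Order.le_val; have /andP[] := s_bounds (valP x). Qed.

HB.instance Definition _ := Order.hasBottom.Build d S subposet_le0x.
HB.instance Definition _ := Order.hasTop.Build d S subposet_lex1.

End Subposet.

Lemma order_isomorphic_trans {d d' d''} {S : porderType d} {T : porderType d'}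
    {U : porderType d''} (A : set S) (B : set T) (C : set U) :
  order_isomorphic A B -> order_isomorphic B C -> order_isomorphic A C.
Proof.
move=> [f fAB fle] [g gBC gle]; exists (g \o f); first exact: set_bij_comp fAB gBC.
move=> x y xA yA /=; rewrite gle ?fle //; apply/mem_set.
  by case: fAB => fAB _ _; apply/fAB/set_mem.
by case: fAB => fAB _ _; apply/fAB/set_mem.
Qed.

(** Two embeddings with the same image in [U]: follow one, then invert the other. [t0] is the value
    given outside [A]. *)
Lemma order_isomorphic_embedding {d d' d''} {S : porderType d} {T : porderType d'}
    {U : porderType d''} (A : set S) (v : S -> U) (g : T -> U) (t0 : T) :
  {mono v : x y / x <= y} -> {mono g : x y / x <= y} ->
  (forall z, A z -> exists t, g t = v z) ->
  (forall t, exists2 z, A z & v z = g t) -> order_isomorphic A [set: T].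
Proof.
move=> vle gle Ag gA.
have /choice[f fP] : forall z, exists t, A z -> g t = v z.
  move=> z; have [/Ag[t gt]|zA] := pselect (A z); first by exists t.
  by exists t0.
exists f; last first.
  by move=> x y /set_mem xA /set_mem yA; rewrite -gle !fP // vle.
split=> // [x y /set_mem xA /set_mem yA fxy|t _].
  by apply: (inc_inj vle); rewrite -!fP // fxy.
have [z zA vz] := gA t; exists z => //.
by apply: (inc_inj gle); rewrite fP.
Qed.

(** * The butterfly with two added minimal elements, in coordinates rank and bit *)

Section BottomedButterfly.
Variable m : nat.
Notation T := (with_bottom (with_bottom (butterfly m))).
Implicit Types t : T.

Definition bb_rank t : nat :=
  match t with None => 0 | Some None => 1 | Some (Some p) => (val p).1.+2 end.

Definition bb_bit t : bool :=
  match t with Some (Some p) => (val p).2 | _ => false end.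

Lemma bb_le t t' : (t <= t') = (t == t') || (bb_rank t < bb_rank t')%N.
Proof. by case: t t' => [[p|]|] [[q|]|] //; apply/esym/orbF. Qed.

Lemma bb_lt t t' : (t < t') = (bb_rank t < bb_rank t')%N.
Proof.
rewrite lt_neqAle bb_le; case: eqVneq => //= ->.
by rewrite ltnn.
Qed.

Lemma bb_ext t t' : bb_rank t = bb_rank t' -> bb_bit t = bb_bit t' -> t = t'.
Proof.
case: t t' => [[[[i b] ?]|]|] [[[[j c] ?]|]|] //= [ij] bc.
by congr (Some (Some _)); apply: val_inj => /=; rewrite bc (val_inj ij).
Qed.

Lemma bb_valid t : (2 < bb_rank t < m.+2)%N || ~~ bb_bit t.
Proof. by case: t => [[[[i b] iP]|]|]. Qed.

Lemma exists_bb k b : (k <= m.+2)%N -> (2 < k < m.+2)%N || ~~ b ->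
  exists t, bb_rank t = k /\ bb_bit t = b.
Proof.
case: k => [|[|k]] /= km; [by case: b => // _; exists None|by case: b => // _; exists (Some None)|].
by move=> bP; exists (Some (Some (exist _ (@Ordinal m.+1 k km, b) bP))).
Qed.

Lemma bb_rank_function : rank_function bb_rank.
Proof.
split=> [t t'|t t' tt' rtt']; first by rewrite bb_lt.
have rm : ((bb_rank t).+1 <= m.+2)%N.
  apply: (leq_trans (ltnW rtt')).
  by case: t' {tt' rtt'} => [[[[i b] ?]|]|] //=; rewrite ltnS ltn_ord.
have [|z [rz _]] := @exists_bb _ false rm; first by rewrite orbT.
by exists z; rewrite !bb_lt rz ltnSn.
Qed.

Lemma bb_rankE t : rank t = bb_rank t.
Proof. exact: (rank_function_rank bb_rank_function). Qed.

End BottomedButterfly.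

Local Close Scope classical_set_scope.

(** * Finite posets with butterfly intervals above the non-bottom elements *)

Lemma double_count {T U : finType} (A : {set T}) (B : {set U}) (R : T -> U -> bool) k l :
  {in A, forall a, #|[set b in B | R a b]| = k} ->
  {in B, forall b, #|[set a in A | R a b]| = l} -> (#|A| * k = #|B| * l)%N.
Proof.
move=> Ak Bl; rewrite -!sum_nat_const.
transitivity (\sum_(a in A) \sum_(b in B | R a b) 1)%N.
  apply: eq_bigr => a /Ak <-; rewrite -sum1_card.
  by apply: eq_bigl => b; rewrite inE.
rewrite (exchange_big_dep (mem B)) /=; last by move=> a b _ /andP[].
apply: eq_bigr => b bB; rewrite -(Bl b) // -sum1_card.
by apply: eq_bigl => a; rewrite inE bB.
Qed.

Lemma coversE {d} {F : finPOrderType d} (r : F -> nat) : rank_function r ->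
  forall x y : F, covers y x = (x < y) && (r y == (r x).+1).
Proof.
move=> rP x y; rewrite -(cov_rank rP); apply/andP/covP => -[xy xyN]; split=> //.
  by move=> z; apply/negP; move/forallP: xyN.
by apply/forallP => z; apply/negP.
Qed.

(** What the twin construction uses of a Sheffer interval, in terms of a finite poset: [B] survives
    only as the two counts in intervals away from the bottom, and the Möbius function only as the
    alternating sum over each initial interval. *)
Record butterfly_sheffer {d} {F : finTBPOrderType d} (r : F -> nat) : Prop := {
  bs_rank : rank_function r ;
  bs_bot : r \bot = 0 ;
  bs_up : forall u v : F, u != \bot -> u <= v -> ((r u).+1 < r v)%N ->
    #|[set z in upper_covers u | z <= v]| = 2 ;
  bs_low : forall u v : F, u != \bot -> u <= v -> ((r u).+1 < r v)%N ->
    #|[set z in lower_covers v | u <= z]| = 2 ;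
  bs_euler : forall v : F, v != \bot ->
    (\sum_(z | (z <= v)%O) (-1) ^+ r z = 0 :> int)%R }.

Section ButterflySheffer.
Context {d : Order.disp_t} {F : finTBPOrderType d} (r : F -> nat).
Hypothesis rS : butterfly_sheffer r.
Implicit Types u v w x y z : F.

Let rP := bs_rank rS.
Let n := r \top.

Lemma rank_le_top x : (r x <= n)%N.
Proof. exact/(rank_function_le rP)/lex1. Qed.

Lemma rank0_bot x : r x = 0 -> x = \bot.
Proof. by move=> rx; apply/esym/(rank_function_eq rP); rewrite ?le0x ?rx. Qed.

Lemma rank_neq_bot x : (0 < r x)%N = (x != \bot).
Proof.
apply/idP/idP => [|x0]; first by apply: contraTneq => ->; rewrite (bs_bot rS).
by rewrite lt0n; apply: contraNneq x0 => /rank0_bot ->.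
Qed.

Lemma rank_top x : r x = n -> x = \top.
Proof. by move=> rx; apply: (rank_function_eq rP); rewrite ?lex1 ?rx. Qed.

Lemma in_upper_covers x y : (y \in upper_covers x) = (x < y) && (r y == (r x).+1).
Proof. by rewrite inE (coversE rP). Qed.

Lemma in_lower_covers x y : (y \in lower_covers x) = (y < x) && (r x == (r y).+1).
Proof. by rewrite inE (coversE rP). Qed.

Lemma exists_atom u : u != \bot -> exists2 a, a <= u & r a = 1.
Proof.
move=> u0; have [||a /andP[_ au] ra] := rank_function_interpolate rP (x := \bot) (y := u) (k := 1).
- exact: le0x.
- by rewrite (bs_bot rS) rank_neq_bot.
- by exists a.
Qed.

(** The elements at height [j] above [u]. *)
Definition level u j : {set F} := [set z | (u <= z) && (r z == r u + j)%N].

Lemma lower_covers_level u j w : u != \bot -> #|level u j.+1| = 2 ->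
  w \in level u j.+2 -> [set z in lower_covers w | u <= z] = level u j.+1.
Proof.
move=> u0 u2; rewrite inE => /andP[uw /eqP rw].
have ruw : ((r u).+1 < r w)%N by lia.
apply/eqP; rewrite eqEcard u2 (bs_low rS) // leqnn andbT.
apply/fintype.subsetP => z; rewrite inE in_lower_covers inE => /andP[/andP[_ /eqP rz] ->] /=.
by apply/eqP; lia.
Qed.

Lemma card_level u j : u != \bot -> (r u + j.+1 < n)%N -> #|level u j.+1| = 2.
Proof.
move=> u0; elim: j => [|j IH] ujn.
  rewrite -(bs_up rS u0 (lex1 u)); last by rewrite -/n; lia.
  apply: eq_card => z; rewrite !inE (coversE rP) lex1 andbT addn1.
  apply: andb_id2r => /eqP rz; rewrite lt_neqAle.
  by case: eqP rz => // <-; lia.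
have {}IH : #|level u j.+1| = 2 by apply: IH; lia.
have /set0Pn[p up] : level u j.+1 != finset.set0 by rewrite -card_gt0 IH.
have := up; rewrite inE => /andP[lup /eqP rp].
have p0 : p != \bot by rewrite -rank_neq_bot rp; lia.
(* Every element of the next level covers every element of this one, so that level is exactly the
   set of upper covers of the single element [p]. *)
rewrite -(bs_up rS p0 (lex1 p)); last by rewrite -/n rp; lia.
apply: eq_card => z; apply/idP/idP => [uz|].
  have := up; rewrite -(lower_covers_level u0 IH uz) inE in_lower_covers => /andP[pz _].
  by rewrite inE in_upper_covers lex1 andbT.
rewrite inE in_upper_covers => /andP[/andP[pz /eqP rz] _].
by rewrite inE (le_trans lup (ltW pz)) rz rp /=; apply/eqP; lia.
Qed.

(** Induction on the rank of [w] leaves the case of adjacent ranks, where [w] covers the whole level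
    containing [v]. *)
Lemma butterfly_lt u v w : u != \bot -> u <= v -> u <= w -> (r v < r w)%N -> v < w.
Proof.
move=> u0 uv; have [k] := ubnP (r w); elim: k w => // k IH w; rewrite ltnS => wk uw vw.
have ruv := rank_function_le rP uv.
have [|c /andP[uc cw] rc] := rank_function_interpolate rP (k := (r w).-1) uw; first by lia.
have [rvc|rvc] := ltnP (r v) (r c).
  by apply: lt_le_trans cw; apply: IH => //; lia.
have rwn := rank_le_top w.
have [j rv] : exists j, (r v = r u + j)%N by exists (r v - r u)%N; lia.
case: j rv => [|j] rv.
  have vu : (r v <= r u)%N by rewrite rv addn0.
  by rewrite -(rank_function_eq rP uv vu); apply: (le_rank_lt uw (r := r)); lia.
have wl : w \in level u j.+2 by rewrite inE uw /=; apply/eqP; lia.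
have vl : v \in level u j.+1 by rewrite inE uv /=; apply/eqP; lia.
have u2 : #|level u j.+1| = 2 by apply: card_level => //; lia.
by move: vl; rewrite -(lower_covers_level u0 u2 wl) inE in_lower_covers => /andP[/andP[]].
Qed.

Lemma card_lower_covers_even w : ~~ odd (r w) -> (0 < r w)%N -> #|lower_covers w| = 2.
Proof.
have [k] := ubnP (r w); elim: k w => // k IH w; rewrite ltnS => wk ev w0.
pose f j := #|[set z | (z <= w) && (r z == j)]|.
have f0 : f 0 = 1.
  rewrite /f -(cards1 (\bot : F)); apply: eq_card => z; rewrite !inE.
  apply/andP/eqP => [[_ /eqP/rank0_bot //]|->]; by rewrite le0x (bs_bot rS).
have fw : f (r w) = 1.
  rewrite /f -(cards1 w); apply: eq_card => z; rewrite !inE.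
  apply/andP/eqP => [[zw /eqP rz]|->]; last by rewrite lexx.
  by apply: (rank_function_eq rP zw); rewrite rz.
(* Double counting of covers: below [w], each element of rank [j] has two upper covers because
   [[z, w]] has length at least 2, and each element of the even rank [j.+1] has two lower covers by
   induction. *)
have fpair j : odd j -> (j.+1 < r w)%N -> f j = f j.+1.
  move=> oj jw; suff : (f j * 2 = f j.+1 * 2)%N by lia.
  apply: (double_count (R := fun z z' => z < z')) => z; rewrite inE => /andP[zw /eqP rz].
    rewrite -(bs_up rS (u := z) (v := w)) ?rz //; last by rewrite -rank_neq_bot rz; lia.
    apply: eq_card => z'; rewrite !inE (coversE rP) rz.
    by case: (z' <= w); case: (z < z'); case: (r z' == j.+1).
  rewrite -(IH z) ?rz //=; last by lia.
    apply: eq_card => z'; rewrite !inE (coversE rP) rz eqSS eq_sym.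
    case z'z : (z' < z); rewrite ?andbT ?andbF //=.
    by rewrite (le_trans (ltW z'z) zw).
  by lia.
have := bs_euler rS (v := w); rewrite -rank_neq_bot => /(_ w0).
(* The rank as an ordinal, so that the sum can be split over a finite type; [inord] does not alter
   it for [z <= w]. *)
pose g z := inord (r z) : 'I_(r w).+1.
rewrite (partition_big g predT) //=.
under eq_bigr => j _.
  have -> : (\sum_(z | (z <= w)%O && (g z == j)) (-1) ^+ r z = (-1) ^+ j * (f j)%:R :> int)%R.
    rewrite /f -sum1_card natr_sum big_distrr /=.
    have gE z : (z <= w) -> (g z == j) = (r z == j).
      by move=> zw; rewrite -val_eqE /= inordK // ltnS (rank_function_le rP).
    rewrite (eq_bigl (fun z => (z <= w) && (r z == j))); last first.
      by move=> z; case zw : (z <= w) => //=; rewrite gE.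
    rewrite [RHS](eq_bigl (fun z => (z <= w) && (r z == j))); last by move=> z; rewrite inE.
    by apply: eq_bigr => z /andP[_ /eqP ->]; rewrite mulr1.
  over.
have [p rw] : exists p, r w = p.*2.+2 by exists (r w)./2.-1; lia.
rewrite -(big_mkord predT (fun j => (-1) ^+ j * (f j)%:R : int)%R) rw.
have s2 i : ((-1) ^+ i.*2 = 1 :> int)%R by rewrite -signr_odd odd_double.
(* Ranks [2j-1] and [2j] cancel and only the bottom contributes. The full Euler relation then reads
   1 - f(2p+1) + 1 = 0. *)
have part i : (i <= p)%N -> (\sum_(0 <= j < i.*2.+1) (-1) ^+ j * (f j)%:R = 1 :> int)%R.
  elim: i => [_|i IHi ip]; first by rewrite big_nat1 f0 expr0 mul1r.
  rewrite doubleS big_nat_recr //= big_nat_recr //= IHi; last by lia.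
  rewrite (fpair i.*2.+1) ?oddS ?odd_double //; last by rewrite rw; lia.
  by rewrite !exprS s2 !mulrA mulrNN !mulN1r !mul1r addrNK.
rewrite big_nat_recr //= big_nat_recr //= part // -rw fw.
have sw : ((-1) ^+ r w = 1 :> int)%R by rewrite -signr_odd (negPf ev).
rewrite sw exprS s2 !mulr1 mulN1r.
move=> fE; have {fE} : f p.*2.+1 = 2 by lia.
move=> <-; apply: eq_card => z; rewrite !inE (coversE rP) rw eqSS eq_sym.
case: (r z =P _) => rz; rewrite ?andbF ?andbT // lt_neqAle.
by case: eqP => // zw; rewrite zw rw in rz; lia.
Qed.

End ButterflySheffer.

(** * Twins *)

Section Twins.
Context {d : Order.disp_t} {F : finTBPOrderType d} (r : F -> nat).
Hypothesis rS : butterfly_sheffer r.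
Implicit Types u v w x y z : F.

Let rP := bs_rank rS.
Let n := r \top.

(** Any common lower bound other than the bottom will do, and it can be lowered to an atom; the
    first disjunct makes the relation reflexive in every rank. *)
Definition twins x y := (x == y) ||
  [&& r x == r y, (2 < r x)%N & [exists u, [&& u != \bot, u <= x & u <= y]]].

Lemma twinsP x y : reflect (x = y \/
    [/\ r x = r y, (2 < r x)%N & exists2 u, r u = 1 & u <= x /\ u <= y])
  (twins x y).
Proof.
apply: (iffP orP) => -[/eqP|]; [by left| |by left|] => H; right.
  case/and3P: H => /eqP rxy rx /existsP[u /and3P[u0 ux uy]]; split=> //.
  have [a au ra] := exists_atom rS u0.
  by exists a => //; rewrite !(le_trans au).
case: H => rxy rx [u ru [ux uy]]; rewrite rxy eqxx -rxy rx; apply/existsP.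
by exists u; rewrite -(rank_neq_bot rS) ru ux uy.
Qed.

Lemma twins_refl x : twins x x. Proof. by rewrite /twins eqxx. Qed.

Lemma twins_rank x y : twins x y -> r x = r y.
Proof. by case/twinsP=> [->|[]]. Qed.

Lemma twins_sym x y : twins x y = twins y x.
Proof.
suff tS u v : twins u v -> twins v u by apply/idP/idP; apply: tS.
case/twinsP=> [->|[ruv ru [a ra [au av]]]]; first exact: twins_refl.
by apply/twinsP; right; rewrite -ruv; split=> //; exists a.
Qed.

Lemma twins_lt_up x y z : twins x y -> x < z -> y < z.
Proof.
case/twinsP=> [-> //|[rxy rx [a ra [ax ay]]]] xz.
apply: (butterfly_lt rS (u := a)) => //; first by rewrite -(rank_neq_bot rS) ra.
  exact: le_trans ax (ltW xz).
by rewrite -rxy (rank_function_lt rP).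
Qed.

Lemma twins_lt_down x y z : twins x y -> z < x -> z < y.
Proof.
case/twinsP=> [-> //|[rxy rx [a ra [ax ay]]]] zx.
have [z0|z0] := posnP (r z).
  rewrite (rank0_bot rS z0) lt0x -(rank_neq_bot rS) -rxy; lia.
have rzx := rank_function_lt rP zx.
have [<- //|xy] := eqVneq x y.
have a0 : a != \bot by rewrite -(rank_neq_bot rS) ra.
(* Odd rank: a cover [w] of [x] also lies above [y], and having even rank it has two coatoms in all.
   The interval [[z, w]] already has two, so [z] lies below every coatom of [w], including [y]. *)
case: (boolP (odd (r x))) => [oddx|evx].
  have [xT|xT] := eqVneq x \top.
    by case/eqP: xy; rewrite xT; apply/esym/(rank_top rS); rewrite -rxy xT.
  have [w xw _] : exists2 w, cov x w & w <= \top by apply: (exists_cov rP); rewrite ltx1.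
  have [{}xw rw] : x < w /\ r w = (r x).+1.
    by move: xw; rewrite (cov_rank rP) => /andP[? /eqP].
  have yw : y < w.
    by apply: (butterfly_lt rS a0) => //; [exact: le_trans ax (ltW xw) | lia].
  have w2 : #|lower_covers w| = 2.
    by apply: (card_lower_covers_even rS); rewrite rw /= ?oddx.
  have z_neq0 : z != \bot by rewrite -(rank_neq_bot rS).
  have zw := ltW (lt_trans zx xw).
  have zw2 := bs_low rS z_neq0 zw.
  have zlw : [set c in lower_covers w | z <= c] = lower_covers w.
    apply/eqP; rewrite eqEcard w2 zw2 ?andbT; last by lia.
    by apply/fintype.subsetP => c; rewrite inE => /andP[].
  have : y \in lower_covers w by rewrite (in_lower_covers rS) yw rw rxy eqxx.
  rewrite -zlw inE => /andP[_ zy].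
  by apply: (le_rank_lt zy (r := r)); rewrite -rxy.
(* Even rank: [x] has two coatoms in all and [[a, x]] already has two, so the coatom [c] over [z]
   lies above [a]; rank alone then puts [c] below [y]. *)
have x2 : #|lower_covers x| = 2 by apply: (card_lower_covers_even rS) => //; lia.
have alx : [set c in lower_covers x | a <= c] = lower_covers x.
  apply/eqP; rewrite eqEcard x2 (bs_low rS) ?andbT //; last by lia.
  by apply/fintype.subsetP => c; rewrite inE => /andP[].
have [c zc cx] := exists_cov_below rP zx.
have [{}cx rc] : c < x /\ r x = (r c).+1.
  by move: cx; rewrite (cov_rank rP) => /andP[? /eqP].
have : c \in lower_covers x by rewrite (in_lower_covers rS) cx rc eqxx.
rewrite -alx inE => /andP[_ ac].
apply: le_lt_trans zc _; apply: (butterfly_lt rS a0) => //; lia.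
Qed.

(** An atom shared by [x] and [y] passes down from [y] to its twin [z], so the same atom serves for
    [x] and [z]. *)
Lemma twins_trans x y z : twins x y -> twins y z -> twins x z.
Proof.
move=> xy yz; case/twinsP: (xy) => [-> //|[rxy rx [a ra [ax ay]]]].
have {}ay : a < y by apply: (le_rank_lt ay (r := r)); lia.
apply/twinsP; right; split=> //; first by rewrite rxy (twins_rank yz).
by exists a => //; split=> //; apply/ltW/(twins_lt_down yz).
Qed.

(** Any transversal would do: strict comparisons do not see which twin is taken, as [twin_rep_lt]
    records. *)
Definition twin_rep x := choose (twins x) x.

Lemma twins_rep x : twins x (twin_rep x).
Proof. exact/chooseP/twins_refl. Qed.

Lemma twin_rep_eq x y : (twin_rep x == twin_rep y) = twins x y.
Proof.
apply/eqP/idP => [xy|xy].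
  apply: twins_trans (twins_rep x) _.
  by rewrite xy twins_sym; apply: twins_rep.
rewrite /twin_rep (choose_id _ xy) ?twins_refl //; apply: eq_choose => z.
by apply/idP/idP; apply: twins_trans; rewrite // twins_sym.
Qed.

Lemma twin_repK x : twin_rep (twin_rep x) = twin_rep x.
Proof. by apply/eqP; rewrite twin_rep_eq twins_sym twins_rep. Qed.

Lemma twin_rep_rank x : r (twin_rep x) = r x.
Proof. by rewrite (twins_rank (twins_rep x)). Qed.

Lemma twins_lt x x' y y' : twins x x' -> twins y y' -> (x < y) = (x' < y').
Proof.
move=> xx yy; apply/idP/idP => lt.
  exact: twins_lt_down yy (twins_lt_up xx lt).
move: xx yy; rewrite twins_sym => xx; rewrite twins_sym => yy.
exact: twins_lt_down yy (twins_lt_up xx lt).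
Qed.

Lemma twin_rep_lt x y : (twin_rep x < twin_rep y) = (x < y).
Proof. by rewrite (twins_lt (twins_rep x) (twins_rep y)). Qed.

Lemma twins_small x y : ((r x <= 2) || (r x == n))%N -> twins x y -> x = y.
Proof.
move=> rx /twinsP[//|[rxy rx2 _]]; move: rx; rewrite leqNgt rx2 /= => /eqP rx.
by rewrite (rank_top rS rx) [y](rank_top rS) // -rxy.
Qed.

Lemma twin_rep_small x : ((r x <= 2) || (r x == n))%N -> twin_rep x = x.
Proof. by move=> rx; apply/esym/(twins_small rx)/twins_rep. Qed.

Lemma twins_pair x : (2 < r x < n)%N ->
  exists2 y, y != x & forall z, twins x z = (z == x) || (z == y).
Proof.
case/andP=> rx xn; have x0 : x != \bot by rewrite -(rank_neq_bot rS); lia.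
have [a ax ra] := exists_atom rS x0.
have a0 : a != \bot by rewrite -(rank_neq_bot rS) ra.
(* All twins of [x] lie over the same atom [a]. The height [(r x).-2.+1] is [r x - 1], written as a
   successor to match [card_level]. *)
have aE z : twins x z = (z \in level r a (r x).-2.+1).
  rewrite inE ra; apply/idP/andP => [xz|[az /eqP rz]].
    rewrite -(twins_rank xz); split; last by apply/eqP; lia.
    by apply/ltW/(twins_lt_down xz)/(le_rank_lt ax (r := r)); lia.
  by apply/twinsP; right; split=> //; [lia | exists a].
have l2 : #|level r a (r x).-2.+1| = 2.
  by apply: (card_level rS a0); rewrite ra -/n; lia.
have /cards2P[p [q [pq lpq]]] : #|level r a (r x).-2.+1| == 2 by rewrite l2.
have := twins_refl x; rewrite aE lpq !inE => /orP[/eqP xp|/eqP xq].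
  by exists q; rewrite ?xp 1?eq_sym // => z; rewrite -xp aE lpq !inE xp.
by exists p; rewrite ?xq // => z; rewrite -xq aE lpq !inE xq orbC.
Qed.

Lemma twin_rep_neq x : x != twin_rep x -> (2 < r x < n)%N.
Proof.
have := rank_le_top rS x; rewrite -/n leq_eqVlt ltnNge => /orP[rx|->].
  by rewrite twin_rep_small ?eqxx // rx orbT.
by rewrite andbT; apply: contraNT; rewrite -leqNgt => rx; rewrite twin_rep_small // rx.
Qed.

(** A class has at most two elements, so one bit, being the representative or not, tells them
    apart. *)
Lemma twin_rep_inj x y : twins x y ->
  (x == twin_rep x) = (y == twin_rep y) -> x = y.
Proof.
move=> xy; have /eqP exy : twin_rep x == twin_rep y by rewrite twin_rep_eq.
case: eqP => [-> /esym/eqP -> //|/eqP xN /esym/negbT yN].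
have [z _ zP] := twins_pair (twin_rep_neq xN).
have := twins_rep x; rewrite zP eq_sym (negPf xN) /= => /eqP xz.
have := xy; rewrite zP => /orP[/eqP //|/eqP yz].
by rewrite -exy xz yz eqxx in yN.
Qed.

(** The lower covers of [x] have rank at least 3 and below the top, and a twin of a lower cover is
    again one, so they come in full pairs. This is the origin of the factor 2 in [C(k)/2]. *)
Lemma card_twin_lower_covers x : (3 < r x)%N ->
  #|lower_covers x| = (#|[set z in lower_covers x | z == twin_rep z]| * 2)%N.
Proof.
move=> rx; rewrite -[LHS]muln1; apply/esym.
apply: (double_count (R := fun q z => twins q z)) => [q|z].
  rewrite inE (in_lower_covers rS) => /andP[/andP[qx /eqP rq] _].
  have [|y yq yP] := @twins_pair q.
    by have := rank_le_top rS x; rewrite -/n rq; lia.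
  have := cards2 q y; rewrite eq_sym yq /= => <-.
  apply: eq_card => z; rewrite !inE -yP (coversE rP).
  case: (boolP (twins q z)) => qz; rewrite ?andbF // andbT.
  by rewrite (twins_lt_up qz qx) rq (twins_rank qz) eqxx.
rewrite (in_lower_covers rS) => /andP[zx /eqP rz].
rewrite -(cards1 (twin_rep z)); apply: eq_card => q; rewrite !inE (coversE rP).
apply/idP/eqP => [/andP[/andP[_ /eqP ->]]|->].
  by rewrite -twin_rep_eq twin_repK => /eqP.
rewrite twin_repK eqxx twins_sym twins_rep !andbT.
by rewrite (twins_lt_up (twins_rep z) zx) twin_rep_rank rz /=.
Qed.

End Twins.

(** * Intervals of rank 3 *)

Section FlagOrbits.
Context {Phi : finType} (s t : Phi -> Phi).
Hypotheses (sK : involutive s) (tK : involutive t).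
Hypotheses (s_neq : forall f, s f <> f) (t_neq : forall f, t f <> f).
Implicit Types f g : Phi.

Definition turn f := t (s f).

Lemma turn_inj : injective turn.
Proof. by apply: inj_comp; apply: inv_inj. Qed.

Let turn_sym := fconnect_sym turn_inj.

(* As s conjugates turn to its inverse, a coincidence for k.+2 at f gives one for k
   at turn f; the descent ends at a fixed point of s or of t. *)
Lemma iter_turn_neq k f : iter k turn f <> s f.
Proof.
suff: forall k f, iter k turn f <> s f /\ iter k.+1 turn f <> s f.
  by move=> H; case: (H k f).
elim=> [|{}k IH] {}f; first by split=> /= e; [case: (s_neq (esym e)) | case: (t_neq e)].
split; first by have [] := IH f.
move=> e; have [+ _] := IH (turn f); apply.
by apply: turn_inj; rewrite -[LHS]/(iter k.+1 turn (turn f)) -iterSr e /turn sK tK.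
Qed.

Lemma fconnect_flip f : ~~ fconnect turn f (s f).
Proof. by apply/negP => /iter_findex; apply: iter_turn_neq. Qed.

(** Conjugation by [s] inverts [turn], so [s] maps orbits to orbits. *)
Lemma fconnect_s f g : fconnect turn (s f) (s g) = fconnect turn f g.
Proof.
suff imp f' g' : fconnect turn f' g' -> fconnect turn (s f') (s g').
  by apply/idP/idP => /imp; rewrite ?sK.
move=> /iter_findex <-; elim: (findex _ _ _) => [|k IH] /=; first exact: connect0.
apply: connect_trans IH _; rewrite turn_sym.
have -> : s (iter k turn f') = turn (s (turn (iter k turn f'))) by rewrite /turn sK tK.
exact: fconnect1.
Qed.

Lemma fconnect_t f : fconnect turn (s f) (t f).
Proof. by rewrite -{2}[f]sK; apply: fconnect1. Qed.

(** The orbits of the group generated by [s] and [t]: an orbit of [turn] together with its image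
    under [s]. *)
Definition same_component f g := fconnect turn f g || fconnect turn f (s g).

Lemma same_component_refl f : same_component f f.
Proof. by rewrite /same_component connect0. Qed.

Lemma same_component_sym f g : same_component f g = same_component g f.
Proof.
rewrite /same_component; congr (_ || _); first exact: turn_sym.
by rewrite -fconnect_s sK turn_sym.
Qed.

Lemma same_component_trans f g h :
  same_component f g -> same_component g h -> same_component f h.
Proof.
case/orP=> fg /orP[] gh; apply/orP.
- by left; apply: connect_trans gh.
- by right; apply: connect_trans gh.
- by right; apply: connect_trans fg _; rewrite fconnect_s.
- by left; apply: connect_trans fg _; rewrite -fconnect_s sK.
Qed.

Definition component_root f := choose (same_component f) f.

Lemma component_rootP f : same_component f (component_root f).
Proof. exact/chooseP/same_component_refl. Qed.

Lemma component_root_eq f g : same_component f g -> component_root f = component_root g.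
Proof.
move=> fg; rewrite /component_root (choose_id _ fg) ?same_component_refl //.
apply: eq_choose => h; apply/idP/idP; apply: same_component_trans => //.
by rewrite same_component_sym.
Qed.

Definition component_roots := [seq f <- enum Phi | component_root f == f].

(* Each component consists of two orbits of turn, exchanged by s; walk follows the
   orbit of the chosen root only, so that it meets every vertex and edge once. *)
Definition walk (f0 : Phi) i j := iter j turn (nth f0 component_roots i).

Definition walk_lengths := [seq order turn f | f <- component_roots].

Variable f0 : Phi.

Lemma component_roots_inj i j : (i < size component_roots)%N ->
  (j < size component_roots)%N ->
  same_component (nth f0 component_roots i) (nth f0 component_roots j) -> i = j.
Proof.
move=> iS jS /component_root_eq.
have rootK k : (k < size component_roots)%N ->
    component_root (nth f0 component_roots k) = nth f0 component_roots k.
  by move/(mem_nth f0); rewrite mem_filter => /andP[/eqP].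
rewrite !rootK // => /eqP; rewrite nth_uniq //; last exact/filter_uniq/enum_uniq.
by move/eqP.
Qed.

Lemma walk_connect i j : fconnect turn (nth f0 component_roots i) (walk f0 i j).
Proof. exact: fconnect_iter. Qed.

Lemma nth_walk_lengths i : (i < size component_roots)%N ->
  nth 0 walk_lengths i = order turn (nth f0 component_roots i).
Proof. by move=> iS; rewrite (nth_map f0). Qed.

Lemma walk_inj i j i' j' : (i < size component_roots)%N ->
  (i' < size component_roots)%N ->
  (j < nth 0 walk_lengths i)%N -> (j' < nth 0 walk_lengths i')%N ->
  walk f0 i j = walk f0 i' j' -> i = i' /\ j = j'.
Proof.
move=> iS iS'; rewrite !nth_walk_lengths // => jS jS' e.
have ii : i = i'.
  apply: component_roots_inj => //; apply/orP; left.
  by apply: connect_trans (walk_connect i j) _; rewrite e turn_sym walk_connect.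
subst i'; split=> //.
by rewrite -(findex_iter jS) -(findex_iter jS') -/(walk f0 i j) e.
Qed.

Lemma walk_neq_s i j i' j' : (i < size component_roots)%N ->
  (i' < size component_roots)%N -> walk f0 i j <> s (walk f0 i' j').
Proof.
move=> iS iS' e.
have ii : i = i'.
  apply: component_roots_inj => //; apply/orP; right.
  apply: connect_trans (walk_connect i j) _; rewrite e fconnect_s turn_sym.
  exact: walk_connect.
subst i'; have /negP := fconnect_flip (walk f0 i j'); apply.
by rewrite -e turn_sym; apply: connect_trans (walk_connect i j'); rewrite turn_sym walk_connect.
Qed.

Lemma walk_neq_t i j i' j' : (i < size component_roots)%N ->
  (i' < size component_roots)%N -> walk f0 i j <> t (walk f0 i' j').
Proof.
move=> iS iS' e; have := fconnect_t (walk f0 i' j'); rewrite -e.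
have ii : fconnect turn (nth f0 component_roots i) (s (walk f0 i' j')) -> False.
  move=> c; have ii : i = i'.
    apply: component_roots_inj => //; apply/orP; right.
    by apply: connect_trans c _; rewrite fconnect_s turn_sym walk_connect.
  subst i'; have /negP := fconnect_flip (walk f0 i j'); apply.
  by apply: connect_trans c; rewrite turn_sym walk_connect.
by rewrite turn_sym => c; apply: ii; apply: connect_trans c; apply: walk_connect.
Qed.

Lemma walk_mod i k : (i < size component_roots)%N ->
  walk f0 i (k %% nth 0 walk_lengths i) = walk f0 i k.
Proof.
move=> iS; rewrite nth_walk_lengths // /walk.
rewrite [in RHS](divn_eq k (order turn (nth f0 component_roots i))).
rewrite addnC iterD; congr iter; elim: (k %/ _) => // m IH.
by rewrite mulSn addnC iterD (iter_order turn_inj).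
Qed.

Lemma walk_onto f : exists i j, [/\ (i < size component_roots)%N,
  (j < nth 0 walk_lengths i)%N & walk f0 i j = f \/ walk f0 i j = s f].
Proof.
have rf : component_root f \in component_roots.
  rewrite mem_filter mem_enum andbT; apply/eqP/esym/component_root_eq.
  exact: component_rootP.
exists (index (component_root f) component_roots).
have iS : (index (component_root f) component_roots < size component_roots)%N.
  by rewrite index_mem.
have walkE g : fconnect turn (component_root f) g ->
    walk f0 (index (component_root f) component_roots) (findex turn (component_root f) g) = g.
  by move=> c; rewrite /walk nth_index // iter_findex.
have := component_rootP f; rewrite same_component_sym => /orP[] c.
  exists (findex turn (component_root f) f); rewrite nth_walk_lengths // nth_index //.
  by split; rewrite ?findex_max //; left; apply: walkE.
exists (findex turn (component_root f) (s f)); rewrite nth_walk_lengths // nth_index //.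
by split; rewrite ?findex_max //; right; apply: walkE.
Qed.

(** An orbit of length one would give [t (s f) = f], that is [s f = t f]. *)
Lemma walk_lengths_ge2 : (forall f, s f <> t f) -> all (leq 2) walk_lengths.
Proof.
move=> st; apply/allP => _ /mapP[f _ ->]; have := order_gt0 turn f.
rewrite leq_eqVlt => /orP[/eqP o1|//].
have := iter_order turn_inj f; rewrite -o1 /= /turn => e.
by case: (st f); rewrite -{2}e tK.
Qed.

End FlagOrbits.

Lemma exists_flip {Phi : finType} {I : eqType} (p : Phi -> I) :
  (forall f, #|[set h | p h == p f]| = 2) ->
  exists s : Phi -> Phi, [/\ involutive s, forall f, s f <> f &
    forall f h, p h = p f <-> h = f \/ h = s f].
Proof.
move=> p2.
have /choice[s sP] : forall f, exists g, g <> f /\ forall h, p h = p f <-> h = f \/ h = g.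
  move=> f; have /eqP/cards2P[g [h [gh ghE]]] := p2 f.
  have pE k : p k = p f <-> k = g \/ k = h.
    have -> : (k = g \/ k = h) <-> k \in [set k | p k == p f].
      by rewrite ghE !inE; split=> [[->|->]|/orP[]/eqP]; rewrite ?eqxx ?orbT; auto.
    by rewrite inE; split=> /eqP.
  have [fg|fh] : f = g \/ f = h by apply/pE.
    by exists h; rewrite {1}fg; split=> [/esym/eqP|k]; [exact/negP | rewrite pE fg].
  exists g; rewrite {1}fh; split=> [/eqP|k]; first exact/negP.
  by rewrite pE fh; split; case; auto.
have sE f : p (s f) = p f by apply/(sP f).2; right.
exists s; split=> [f|f|f h]; [|exact: (sP f).1|exact: (sP f).2].
have : p (s (s f)) = p f by rewrite !sE.
by case/(sP f).2 => // e; case: (sP (s f)).1.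
Qed.

(** * Flags of a rank 3 interval and its decomposition into polygons *)

Section RankThree.
Context {d : Order.disp_t} {F : finTBPOrderType d} (r : F -> nat).
Hypothesis rS : butterfly_sheffer r.
Variable x : F.
Hypothesis rx : r x = 3.

Let rP := bs_rank rS.

(** A flag is a vertex with an incident edge, hence a direction of travel, which makes advancing
    along a polygon a permutation. It also keeps apart the two edges of a 2-gon, which have the same
    vertices. *)
Definition flag := {p : F * F | (p.2 \in lower_covers x) && (p.1 \in lower_covers p.2)}.
HB.instance Definition _ := Finite.on flag.

Definition flag_vertex (f : flag) : F := (val f).1.
Definition flag_edge (f : flag) : F := (val f).2.

Notation a := flag_vertex.
Notation e := flag_edge.

Lemma flag_lt f : a f < e f.
Proof. by have /andP[_] := valP f; rewrite (in_lower_covers rS) => /andP[]. Qed.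

Lemma flag_edge_lt f : e f < x.
Proof. by have /andP[] := valP f; rewrite (in_lower_covers rS) => /andP[]. Qed.

Lemma flag_edge_rank f : r (e f) = 2.
Proof. by have /andP[] := valP f; rewrite (in_lower_covers rS) rx => /andP[_ /eqP[]]. Qed.

Lemma flag_vertex_rank f : r (a f) = 1.
Proof.
have /andP[_] := valP f; rewrite (in_lower_covers rS) => /andP[_].
by rewrite -/(e f) flag_edge_rank => /eqP[].
Qed.

Lemma exists_flag v w : v < w -> w < x -> r v = 1 -> exists2 f, a f = v & e f = w.
Proof.
move=> vw wx rv; have := rank_function_lt rP vw; have := rank_function_lt rP wx.
rewrite rv rx ltnS => w2 w1; have {w1 w2}rw : r w = 2 by apply/eqP; rewrite eqn_leq w2 w1.
have wf : ((v, w).2 \in lower_covers x) && ((v, w).1 \in lower_covers (v, w).2).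
  by rewrite !(in_lower_covers rS) /= vw wx rx rw rv.
by exists (exist _ (v, w) wf).
Qed.

Lemma flag_eq f g : a f = a g -> e f = e g -> f = g.
Proof.
move=> afg efg; apply: val_inj; rewrite [val f]surjective_pairing [val g]surjective_pairing.
by congr (_, _).
Qed.

Lemma card_flags_edge f : #|[set h | e h == e f]| = 2.
Proof.
rewrite -(card_lower_covers_even rS (w := e f)) ?flag_edge_rank //.
rewrite -(card_in_imset (f := a)); last first.
  by move=> g h; rewrite !inE => /eqP eg /eqP eh agh; apply: flag_eq; rewrite ?eg ?eh.
apply: eq_card => v; apply/imsetP/idP => [[h + ->]|].
  by rewrite inE => /eqP <-; rewrite (in_lower_covers rS) flag_lt flag_edge_rank flag_vertex_rank.
rewrite (in_lower_covers rS) flag_edge_rank => /andP[vf /eqP[rv]].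
have [|h ah eh] := exists_flag vf (flag_edge_lt f); first by rewrite -rv.
by exists h; rewrite ?inE ?eh.
Qed.

Lemma card_flags_vertex f : #|[set h | a h == a f]| = 2.
Proof.
have a0 : a f != \bot by rewrite -(rank_neq_bot rS) flag_vertex_rank.
have ax := lt_trans (flag_lt f) (flag_edge_lt f).
rewrite -(bs_up rS a0 (ltW ax)) ?flag_vertex_rank ?rx //.
rewrite -(card_in_imset (f := e)); last first.
  by move=> g h; rewrite !inE => /eqP ag /eqP ah egh; apply: flag_eq; rewrite ?ag ?ah.
apply: eq_card => w; apply/imsetP/idP => [[h + ->]|].
  rewrite inE => /eqP <-; rewrite inE (in_upper_covers rS) flag_lt flag_edge_rank.
  by rewrite flag_vertex_rank (ltW (flag_edge_lt h)).
rewrite inE (in_upper_covers rS) flag_vertex_rank => /andP[/andP[fw /eqP rw] wx].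
have {}wx : w < x by apply: (le_rank_lt wx (r := r)); rewrite rw rx.
have [|h ah eh] := exists_flag fw wx; first exact: flag_vertex_rank.
by exists h; rewrite ?inE ?ah.
Qed.

Lemma rank3_polygons : exists (qs : seq nat) (g : polygons qs -> F),
  [/\ all (leq 2) qs, sumn qs = #|lower_covers x|, {mono g : u v / u <= v} &
      forall z, z <= x <-> exists u, g u = z].
Proof.
(* [s] keeps the edge and changes the vertex, [t] keeps the vertex and changes the edge; [turn] thus
   moves along the edge to its other end and then to the next edge there. *)
have [s [sK s_neq sE]] := exists_flip card_flags_edge.
have [t [tK t_neq tE]] := exists_flip card_flags_vertex.
have st f : s f <> t f.
  move=> stf; apply: (s_neq f); apply: flag_eq; last by apply/sE; right.
  by rewrite stf; apply/tE; right.
have x0 : \bot < x by rewrite lt0x -(rank_neq_bot rS) rx.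
have [f0 _] : exists f0 : flag, True.
  have [||v /andP[_ vx] rv] := rank_function_interpolate rP (x := \bot) (y := x) (k := 1).
  - exact: le0x.
  - by rewrite (bs_bot rS) rx.
  have [||w /andP[vw wx] rw] := rank_function_interpolate rP (x := v) (y := x) (k := 2).
  - by [].
  - by rewrite rv rx.
  have [|||f _ _] := @exists_flag v w; last by exists f.
  - by apply: (le_rank_lt vw (r := r)); rewrite rv rw.
  - by apply: (le_rank_lt wx (r := r)); rewrite rw rx.
  - exact: rv.
pose rs := component_roots s t; pose qs := walk_lengths s t.
have szq : size qs = size rs by rewrite size_map.
pose fl (u : polygon_faces qs) := walk s t f0 (tag u) (tagged u).1.
pose face (u : polygon_faces qs) := if (tagged u).2 then e (fl u) else a (fl u).
pose g (u : polygons qs) : F :=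
  match u with None => \bot | Some None => x | Some (Some u) => face u end.
have ltS (i : 'I_(size qs)) : (i < size rs)%N by rewrite -szq.
have walkE (i k : 'I_(size qs)) (j : 'I_(nth 0 qs i)) (l : 'I_(nth 0 qs k)) :
    walk s t f0 i j = walk s t f0 k l <-> i = k :> nat /\ j = l :> nat.
  by split=> [/walk_inj|[ik jl]]; [apply; rewrite ?ltS | rewrite jl ik].
have face_rank u : r (face u) = (tagged u).2.+1.
  by rewrite /face; case: ifP => _; rewrite ?flag_edge_rank ?flag_vertex_rank.
have face_lt u : face u < x.
  rewrite /face; case: ifP => _; first exact: flag_edge_lt.
  exact: lt_trans (flag_lt _) (flag_edge_lt _).
(* Indices are compared as natural numbers, since [j] and [l] live in different ordinal types until
   [i = k] is known; [l.+1 %% nth 0 qs k] is the value of [ordS l]. *)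
have leE (i k : 'I_(size qs)) (j : 'I_(nth 0 qs i)) (l : 'I_(nth 0 qs k)) b c :
    (Tagged (fun i : 'I_(size qs) => polygon_face (nth 0 qs i)) (j, b) : polygon_faces qs)
    <= Tagged (fun i : 'I_(size qs) => polygon_face (nth 0 qs i)) (l, c) =
    ((i == k :> nat) && ((j == l :> nat) && ~~ (b (+) c) ||
      [&& ~~ b, c & (j == l :> nat) || (j == l.+1 %% nth 0 qs k :> nat)])).
  rewrite -[LHS]/(polygon_faces_le _ _) /polygon_faces_le /= val_eqE.
  case: eqVneq => //= ik; subst k; rewrite tagged_asE /polygon_face_le xpair_eqE /=.
  by rewrite -!val_eqE; case: b c => [] [].
have rank_le p q : r p = r q -> (p <= q) = (p == q).
  move=> rpq; apply/idP/eqP => [pq|-> //]; apply: (rank_function_eq rP pq).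
  by rewrite rpq.
have walk_succ (k : 'I_(size qs)) l :
    walk s t f0 k (l.+1 %% nth 0 qs k) = turn s t (walk s t f0 k l).
  by rewrite walk_mod.
(* The flag with the vertex of [f] and the edge of [h] is [f] or [t f], and also [h] or [s h]. On
   the walk the last two outcomes are impossible; the first two are the two incidences of
   [polygon_face_le]. *)
have incident f h : a f < e h -> [\/ f = h, f = turn s t h, f = s h | t f = h].
  move=> fh; have [|c /tE cf /sE ch] := exists_flag fh (flag_edge_lt h).
    exact: flag_vertex_rank.
  case: cf ch => -> []; first by constructor 1.
  - by constructor 3.
  - by constructor 4.
  - by move=> tf; constructor 2; rewrite /turn -tf tK.
have face_le (u v : polygon_faces qs) : (face u <= face v) = (u <= v).
  case: u v => i [j b] [k [l c]]; rewrite leE /face /fl /=.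
  have i_lt := ltS i; have k_lt := ltS k.
  case: b c => [] [] /=; rewrite ?andbT ?andbF ?orbF ?orFb.
  - rewrite rank_le ?flag_edge_rank //; apply/eqP/andP => [/sE[|]|].
    + by move/walkE=> [/eqP -> /eqP ->].
    + by move/walk_neq_s; case.
    + by move=> [/eqP ik /eqP jl]; congr e; apply/walkE.
  - by apply/negP => /(rank_function_le rP); rewrite flag_edge_rank flag_vertex_rank.
  - have q_gt0 : (l.+1 %% nth 0 qs k < nth 0 qs k)%N.
      by rewrite ltn_mod; apply: leq_ltn_trans (ltn_ord l).
    apply/idP/andP => [fh|[/eqP ik /orP[] /eqP jl]].
    + have {}fh := le_rank_lt (r := r) fh; rewrite flag_vertex_rank flag_edge_rank in fh.
      case: (incident _ _ (fh isT)).
      * by move/walkE=> [/eqP -> /eqP ->].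
      * rewrite -walk_succ => /(walkE i k j (Ordinal q_gt0))[/eqP -> /eqP /= ->].
        by rewrite orbT.
      * by move/walk_neq_s; case.
      * by move/esym/walk_neq_t; case.
    + by rewrite (walkE i k j l).2 ?(ltW (flag_lt _)).
    + rewrite (walkE i k j (Ordinal q_gt0)).2 //=. rewrite (walk_succ k l); apply/ltW.
      have <- : a (t (turn s t (walk s t f0 k l))) = a (turn s t (walk s t f0 k l)).
        by apply/tE; right.
      rewrite /turn tK; have <- : e (s (walk s t f0 k l)) = e (walk s t f0 k l).
        by apply/sE; right.
      exact: flag_lt.
  - rewrite rank_le ?flag_vertex_rank //; apply/eqP/andP => [/tE[|]|].
    + by move/walkE=> [/eqP -> /eqP ->].
    + by move/walk_neq_t; case.
    + by move=> [/eqP ik /eqP jl]; congr a; apply/walkE.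
have fl_onto f : exists (i : 'I_(size qs)) (j : 'I_(nth 0 qs i)),
    walk s t f0 i j = f \/ walk s t f0 i j = s f.
  have [i [j [iS jq wE]]] := walk_onto sK tK f0 f.
  by rewrite -szq in iS; exists (Ordinal iS), (Ordinal jq).
exists qs, g; split.
- exact: walk_lengths_ge2.
(* Positions of the walk correspond to edges: [s] preserves the edge, so reaching [f] or [s f]
   reaches each edge, and never meeting both makes the correspondence injective. *)
- pose edge (u : {i : 'I_(size qs) & 'I_(nth 0 qs i)}) := walk s t f0 (tag u) (tagged u).
  have edge_inj : injective (e \o edge).
    move=> [i j] [k l] /= /sE[/walkE[ik jl]|]; last by move/walk_neq_s; case; rewrite ?ltS.
    have {}ik : i = k := val_inj ik.
    by subst k; rewrite (val_inj jl : j = l).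
  have -> : lower_covers x = [set e (edge u) | u in [set: {i : 'I_(size qs) & 'I_(nth 0 qs i)}]].
    apply/setP => w; rewrite (in_lower_covers rS) rx; apply/idP/imsetP => [/andP[wx /eqP[rw]]|[u _ ->]].
      have w_gt0 : \bot < w by rewrite lt0x -(rank_neq_bot rS) -rw.
      have [v _] := exists_cov_below rP w_gt0.
      rewrite (cov_rank rP) -rw => /andP[vw /eqP[rv]].
      have [f _ <-] := exists_flag vw wx (esym rv).
      have [i [j wE]] := fl_onto f.
      exists (Tagged (fun i : 'I_(size qs) => 'I_(nth 0 qs i)) j) => //.
      by apply/sE; rewrite /edge /=; case: wE => ->; rewrite ?sK; auto.
    by rewrite flag_edge_lt flag_edge_rank.
  rewrite (card_imset _ edge_inj) cardsT card_tagged.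
  have -> : map (fun i : 'I_(size qs) => #|{: 'I_(nth 0 qs i)}|) (enum 'I_(size qs)) = qs.
    apply: (@eq_from_nth _ 0) => [|i]; rewrite size_map size_enum_ord // => iq.
    by rewrite (nth_map (Ordinal iq)) ?size_enum_ord // card_ord nth_enum_ord.
  by [].
- move=> [[u|]|] [[v|]|].
  + exact: (face_le u v).
  + exact/ltW/face_lt.
  + by rewrite -[RHS]/false lex0; apply/negbTE; rewrite -(rank_neq_bot rS) face_rank.
  + by rewrite -[RHS]/false; apply/negbTE/negP => /(lt_le_trans (face_lt v)); rewrite ltxx.
  + by rewrite lexx.
  + by rewrite -[RHS]/false lex0; apply/negbTE; rewrite -(rank_neq_bot rS) rx.
  + by rewrite le0x.
  + by rewrite le0x.
  + by rewrite lexx.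
- move=> z; split=> [zx|[[[u|]|] <-]]; last first.
  + exact: le0x.
  + exact: lexx.
  + exact/ltW/face_lt.
  have [->|z0] := eqVneq z \bot; first by exists None.
  have [->|zx'] := eqVneq z x; first by exists (Some None).
  have {zx zx'}zx : z < x by rewrite lt_neqAle zx'.
  suff [u <-] : exists u, face u = z by exists (Some (Some u)).
  have fl_edge f : exists u, face u = e f.
    have [i [j wE]] := fl_onto f.
    exists (Tagged (fun i : 'I_(size qs) => polygon_face (nth 0 qs i)) (j, true)).
    by rewrite /face /fl /=; apply/sE.
  have fl_vertex f : exists u, face u = a f.
    have [i [j [<-|wE]]] := fl_onto f.
      by exists (Tagged (fun i : 'I_(size qs) => polygon_face (nth 0 qs i)) (j, false)).
    (* The walk passes through [s f] instead of [f]. Its next flag is [turn (s f) = t f], which has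
       the vertex of [f]. *)
    have q_gt0 : (j.+1 %% nth 0 qs i < nth 0 qs i)%N.
      by rewrite ltn_mod; apply: leq_ltn_trans (ltn_ord j).
    exists (Tagged (fun i : 'I_(size qs) => polygon_face (nth 0 qs i)) (Ordinal q_gt0, false));
    rewrite /face /fl /= walk_succ.
    by apply/tE; right; rewrite /turn wE sK.
  have [rz|rz] : r z = 1 \/ r z = 2.
    have := rank_function_lt rP zx; move: z0; rewrite -(rank_neq_bot rS) rx.
    by case: (r z) => [|[|[|]]] //; auto.
  - have [w] := exists_cov rP zx; rewrite (cov_rank rP) rz => /andP[zw /eqP rw] wx.
    have {}wx : w < x by apply: (le_rank_lt wx (r := r)); rewrite rw rx.
    by have [f <- _] := exists_flag zw wx rz; apply: fl_vertex.
  - have z_gt0 : \bot < z by rewrite lt0x.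
    have [v _] := exists_cov_below rP z_gt0.
    rewrite (cov_rank rP) rz => /andP[vz /eqP [rv]].
    by have [f _ <-] := exists_flag vz zx (esym rv); apply: fl_edge.
Qed.

End RankThree.

Local Open Scope classical_set_scope.
Local Open Scope order_scope.

(** * The quotient by twins *)

Section Factorization.
Context {d : Order.disp_t} {F : finTBPOrderType d} (r : F -> nat).
Hypothesis rS : butterfly_sheffer r.
Implicit Types x y z : F.

Let rP := bs_rank rS.

Definition twin_reps := [seq x <- enum F | x == twin_rep r x].

Lemma mem_twin_reps x : (x \in twin_reps) = (x == twin_rep r x).
Proof. by rewrite mem_filter mem_enum andbT. Qed.

Lemma small_twin_reps x : ((r x <= 2) || (r x == r \top))%N -> x \in twin_reps.
Proof. by move=> rx; rewrite mem_twin_reps (twin_rep_small rS rx). Qed.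

Fact bot_twin_reps : \bot \in twin_reps.
Proof. by apply: small_twin_reps; rewrite (bs_bot rS). Qed.

Fact top_twin_reps : \top \in twin_reps.
Proof. by apply: small_twin_reps; rewrite eqxx orbT. Qed.

Fact twin_reps_bounds x : x \in twin_reps -> \bot <= x <= \top.
Proof. by rewrite le0x lex1. Qed.

Definition twin_quotient : finTBPOrderType d :=
  subposet bot_twin_reps top_twin_reps twin_reps_bounds.

Notation Q := twin_quotient.
Implicit Types q : Q.

Fact twin_rep_reps x : twin_rep r x \in twin_reps.
Proof. by rewrite mem_twin_reps (twin_repK rS). Qed.

Definition twin_class x : Q := SeqSub (twin_rep_reps x).

Definition twin_val q : F := val q.

Lemma twin_val_le q q' : (twin_val q <= twin_val q') = (q <= q').
Proof. exact: Order.le_val. Qed.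

Lemma twin_val_lt q q' : (twin_val q < twin_val q') = (q < q').
Proof. by rewrite !lt_leAnge !twin_val_le. Qed.

Lemma twin_val_inj : injective twin_val.
Proof. exact: val_inj. Qed.

Lemma twin_valK q : twin_rep r (twin_val q) = twin_val q.
Proof. by have := valP q; rewrite mem_twin_reps => /eqP. Qed.

Lemma twin_class_val x : twin_val (twin_class x) = twin_rep r x.
Proof. by []. Qed.

Lemma twin_val_onto x : x = twin_rep r x -> exists q, twin_val q = x.
Proof. by move=> xx; exists (twin_class x); rewrite twin_class_val -xx. Qed.

Definition twin_rank q := r (twin_val q).

(** An intermediate element can be replaced by its representative, which satisfies the same strict
    inequalities. *)
Lemma twin_rank_function : rank_function twin_rank.
Proof.
split=> [q q'|q q' qq' rqq'].
  by rewrite -twin_val_lt; apply: (rank_function_lt rP).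
move: (qq'); rewrite -twin_val_lt => /(rP.2 _ _)/(_ rqq')[z].
exists (twin_class z); rewrite -!twin_val_lt twin_class_val.
by rewrite -(twin_valK q) -(twin_valK q') !(twin_rep_lt rS).
Qed.

Lemma twin_rankE q : rank q = twin_rank q.
Proof. exact: (rank_function_rank twin_rank_function (bs_bot rS)). Qed.

Lemma card_quotient_upper_covers q :
  #|upper_covers q| = #|[set z in upper_covers (twin_val q) | z == twin_rep r z]|%SET.
Proof.
rewrite -(card_imset _ twin_val_inj); apply: eq_card => z.
rewrite !inE; apply/imsetP/andP => [[q' + ->]|[+ /eqP zr]].
  rewrite inE (coversE rP) (coversE twin_rank_function) twin_val_lt => ->.
  by rewrite twin_valK.
have [q' <-] := twin_val_onto zr.
by exists q' => //; rewrite inE (coversE twin_rank_function) -twin_val_lt -(coversE rP).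
Qed.

Lemma card_quotient_lower_covers q :
  #|lower_covers q| = #|[set z in lower_covers (twin_val q) | z == twin_rep r z]|%SET.
Proof.
rewrite -(card_imset _ twin_val_inj); apply: eq_card => z.
rewrite !inE; apply/imsetP/andP => [[q' + ->]|[+ /eqP zr]].
  rewrite inE (coversE rP) (coversE twin_rank_function) twin_val_lt => ->.
  by rewrite twin_valK.
have [q' <-] := twin_val_onto zr.
by exists q' => //; rewrite inE (coversE twin_rank_function) -twin_val_lt -(coversE rP).
Qed.

(** The upper covers of [q] in the interval have equal rank at least 3 and share the lower bound
    [q], so they form a single twin class. *)
Lemma quotient_upper_covers q : (2 <= twin_rank q)%N -> q != \top -> #|upper_covers q| = 1.
Proof.
move=> rq qT; have qlt : twin_val q < twin_val \top by rewrite twin_val_lt ltx1.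
have [z] := exists_cov rP qlt; rewrite (cov_rank rP) => /andP[qz /eqP rz] _.
rewrite card_quotient_upper_covers -(cards1 (twin_rep r z)); apply: eq_card => w.
rewrite !inE (coversE rP); apply/andP/eqP => [[/andP[qw /eqP rw] /eqP ->]|->].
  apply/eqP; rewrite (twin_rep_eq rS); apply/orP; right.
  rewrite rz rw eqxx ltnS rq /=; apply/existsP; exists (twin_val q).
  by rewrite (ltW qz) (ltW qw) -(rank_neq_bot rS) (leq_trans _ rq).
rewrite (twin_repK rS) (twin_rep_rank rS) rz !eqxx andbT; split=> //.
by rewrite -(twin_valK q) (twin_rep_lt rS).
Qed.

(** The covers of an atom have rank 2, where nothing is identified. In total rank 2 the top would be
    the only cover. *)
Lemma quotient_upper_covers_atom q : (2 < r \top)%N -> twin_rank q = 1 ->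
  #|upper_covers q| = 2.
Proof.
move=> rT rq; have q0 : twin_val q != \bot by rewrite -(rank_neq_bot rS) -/(twin_rank q) rq.
rewrite card_quotient_upper_covers -(bs_up rS q0 (lex1 _)) -/(twin_rank q) ?rq //.
apply: eq_card => z; rewrite !inE (coversE rP) lex1 -/(twin_rank q) rq.
apply: andb_id2l => /andP[_ /eqP rz].
by rewrite (twin_rep_small rS) ?eqxx // rz.
Qed.

Lemma quotient_lower_covers_even q : ~~ odd (twin_rank q) -> (4 <= twin_rank q)%N ->
  #|lower_covers q| = 1.
Proof.
move=> ev rq; have r3 : (3 < r (twin_val q))%N by [].
have := card_twin_lower_covers rS r3.
rewrite -card_quotient_lower_covers (card_lower_covers_even rS ev) ?(leq_trans _ rq) //.
by case: #|_| => [|[|k]].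
Qed.

Lemma quotient_lower_covers q : (4 <= twin_rank q)%N ->
  #|lower_covers (twin_val q)| = (#|lower_covers q| * 2)%N.
Proof. by move=> rq; rewrite card_quotient_lower_covers (card_twin_lower_covers rS). Qed.

(** Strictly below [q] the ranks are at most 2, so each element is its own representative and the
    interval is unchanged in the quotient. For the same reason the number of coatoms is not halved
    here. *)
Lemma quotient_polygons q : twin_rank q = 3 -> exists qs : seq nat,
  [/\ all (leq 2) qs, sumn qs = #|lower_covers (twin_val q)| &
      order_isomorphic [set` `[\bot, q]] [set: polygons qs]].
Proof.
move=> rq; have [qs [g [qs2 sqs gle gE]]] := rank3_polygons rS rq.
exists qs; split=> //.
apply: (order_isomorphic_embedding (v := twin_val) (g := g) \bot) => //.
- by move=> z /=; rewrite in_itv /= le0x /= -twin_val_le => /gE.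
move=> t; have gq : g t <= twin_val q by apply/gE; exists t.
have [|z zg] := @twin_val_onto (g t); last first.
  by exists z => //=; rewrite in_itv /= le0x -twin_val_le zg.
have [gtq|] := eqVneq (g t) (twin_val q); first by rewrite gtq twin_valK.
move=> gtq; apply/esym/(twin_rep_small rS).
have : g t < twin_val q by rewrite lt_neqAle gtq.
by move/(rank_function_lt rP); rewrite -/(twin_rank q) rq ltnS => ->.
Qed.

Lemma twin_factorization m : r \top = m.+2 ->
  order_isomorphic [set: F] (rank_product (with_bottom (with_bottom (butterfly m))) Q).
Proof.
move=> rT.
(* Elements that are not representatives occur only in the ranks where the raised butterfly has two
   elements. *)
have bit_ok x : (2 < r x < m.+2)%N || ~~ (x != twin_rep r x).
  by rewrite orbC -implybE; apply/implyP => /(twin_rep_neq rS); rewrite rT.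
have /choice[tw twP] : forall x,
    exists t : with_bottom (with_bottom (butterfly m)),
      bb_rank t = r x /\ bb_bit t = (x != twin_rep r x).
  by move=> x; apply: exists_bb (bit_ok x); rewrite -rT (rank_le_top rS).
have tw_rank x : bb_rank (tw x) = r x by case: (twP x).
have tw_bit x : bb_bit (tw x) = (x != twin_rep r x) by case: (twP x).
exists (fun x => (tw x, twin_class x)); last first.
  move=> x y _ _; rewrite leEprod /= bb_le !tw_rank -twin_val_le !twin_class_val.
  (* Equal butterfly coordinates give equal ranks, so the comparable classes coincide and the bit
     identifies the elements. A strict inequality of ranks makes the comparison of classes strict,
     and it then lifts to [x] and [y]. *)
  apply/andP/idP => [[/orP[/eqP txy|rxy] cxy]|].
  - have rxy : r x = r y by rewrite -!tw_rank txy.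
    suff -> : x = y by [].
    apply: (twin_rep_inj rS).
      rewrite -(twin_rep_eq rS); apply/eqP/(rank_function_eq rP cxy).
      by rewrite !(twin_rep_rank rS) rxy.
    by apply: negb_inj; rewrite -!tw_bit txy.
  - apply/ltW; rewrite -(twin_rep_lt rS); apply: (le_rank_lt cxy (r := r)).
    by rewrite !(twin_rep_rank rS).
  rewrite le_eqVlt => /orP[/eqP ->|xy]; first by rewrite eqxx lexx.
  by rewrite (rank_function_lt rP xy) orbT ltW // (twin_rep_lt rS).
split.
- move=> x _; rewrite /rank_product /= bb_rankE tw_rank twin_rankE.
  by rewrite /twin_rank twin_class_val (twin_rep_rank rS).
- move=> x y _ _ [txy cxy].
  apply: (twin_rep_inj rS); first by rewrite -(twin_rep_eq rS) cxy.
  by apply: negb_inj; rewrite -!tw_bit txy.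
case=> t q; rewrite /rank_product /= bb_rankE twin_rankE => tq.
suff [x xq xb] : exists2 x, twin_rep r x = twin_val q & (x != twin_rep r x) = bb_bit t.
  exists x => //; congr (_, _); last by apply: twin_val_inj; rewrite twin_class_val.
  by apply: bb_ext; rewrite ?tw_rank ?tw_bit // tq /twin_rank -xq (twin_rep_rank rS).
(* Bit false is realized by the representative itself; bit true occurs only in ranks where that
   representative has a twin. *)
have := bb_valid t; case tb : (bb_bit t); last first.
  by exists (twin_val q); rewrite twin_valK ?eqxx.
rewrite orbF tq -rT => /(twins_pair rS)[x xq /(_ x)]; rewrite eqxx orbT => qx.
have xr : twin_rep r x = twin_val q.
  by rewrite -(twin_valK q); apply/esym/eqP; rewrite (twin_rep_eq rS).
by exists x; rewrite xr.
Qed.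

End Factorization.

(** * Initial intervals of a Sheffer poset *)

Lemma card_eq_II_inj {T : Type} (A : set T) m n : A #= `I_m -> A #= `I_n -> m = n.
Proof. by move=> Am An; apply/card_eq_II; rewrite -(card_eql Am). Qed.

Section InitialInterval.
Context {d : Order.disp_t} {P : bPOrderType d} (y : P) (e : seq P).
Hypothesis eE : forall x, (x \in e) = (x <= y).

Fact bot_interval : \bot \in e. Proof. by rewrite eE le0x. Qed.
Fact top_interval : y \in e. Proof. by rewrite eE. Qed.
Fact interval_bounds x : x \in e -> \bot <= x <= y.
Proof. by rewrite eE le0x. Qed.

Definition initial_interval : finTBPOrderType d :=
  subposet bot_interval top_interval interval_bounds.

Notation F := initial_interval.

Definition interval_val (z : F) : P := val z.

Lemma interval_val_le (u v : F) : (interval_val u <= interval_val v) = (u <= v).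
Proof. exact: Order.le_val. Qed.

Lemma interval_val_lt (u v : F) : (interval_val u < interval_val v) = (u < v).
Proof. by rewrite !lt_leAnge !interval_val_le. Qed.

Lemma interval_val_inj : injective interval_val.
Proof. exact: val_inj. Qed.

Lemma interval_val_top (u : F) : interval_val u <= y.
Proof. by rewrite -eE; apply: valP. Qed.

Lemma interval_val_onto x : x <= y -> exists u, interval_val u = x.
Proof. by rewrite -eE => xe; exists (SeqSub xe). Qed.

Lemma interval_isomorphic : order_isomorphic [set` `[\bot, y]] [set: F].
Proof.
apply: (order_isomorphic_embedding (v := id) (g := interval_val) \bot) => //.
  by move=> z /=; rewrite in_itv /= le0x => /interval_val_onto.
by move=> t; exists (interval_val t) => //=; rewrite in_itv /= le0x interval_val_top.
Qed.

Hypothesis rankP : rank_function (@rank _ P).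

Definition interval_rank (u : F) := rank (interval_val u).

Lemma interval_rank_function : rank_function interval_rank.
Proof.
split=> [u v|u v]; rewrite -interval_val_lt; first exact: (rank_function_lt rankP).
move=> uv /(rankP.2 _ _ uv)[z /andP[uz zv]].
have [w wz] := interval_val_onto (le_trans (ltW zv) (interval_val_top v)).
by exists w; rewrite -!interval_val_lt wz uz.
Qed.

Let rP := interval_rank_function.

Lemma interval_cov (u v : F) : cov (interval_val u) (interval_val v) = covers v u.
Proof. by rewrite (cov_rank rankP) (coversE rP) interval_val_lt. Qed.

Lemma card_interval_up (u v : F) k : u < v ->
  (forall z, covers z u -> z <= v ->
     maximal_chains (interval_val z) (interval_val v) #= `I_k) ->
  maximal_chains (interval_val u) (interval_val v) #=
    `I_(#|[set z in upper_covers u | (z <= v)%O]%SET| * k).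
Proof.
move=> uv uk; rewrite cardE -(size_map interval_val).
apply: card_maximal_chains_cons.
- by rewrite interval_val_lt.
- by rewrite map_inj_uniq ?enum_uniq //; apply: interval_val_inj.
- move=> z; apply/mapP/andP => [[w + ->]|[uz zv]].
    by rewrite interval_cov interval_val_le mem_enum !inE => /andP.
  have [w wz] := interval_val_onto (le_trans zv (interval_val_top v)).
  by exists w => //; rewrite mem_enum !inE -interval_cov -interval_val_le wz uz.
- by move=> _ /mapP[w + ->]; rewrite mem_enum !inE => /andP[]; apply: uk.
Qed.

Lemma card_interval_low (u v : F) k : u < v ->
  (forall z, covers v z -> u <= z ->
     maximal_chains (interval_val u) (interval_val z) #= `I_k) ->
  maximal_chains (interval_val u) (interval_val v) #=
    `I_(#|[set z in lower_covers v | (u <= z)%O]%SET| * k).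
Proof.
move=> uv uk; rewrite cardE -(size_map interval_val).
apply: card_maximal_chains_rcons.
- by rewrite interval_val_lt.
- by rewrite map_inj_uniq ?enum_uniq //; apply: interval_val_inj.
- move=> z; apply/mapP/andP => [[w + ->]|[zv uz]].
    by rewrite interval_cov interval_val_le mem_enum !inE => /andP.
  have [w wz] := interval_val_onto (le_trans (ltW (cov_lt zv)) (interval_val_top v)).
  by exists w => //; rewrite mem_enum !inE -interval_cov -interval_val_le wz zv.
- by move=> _ /mapP[w + ->]; rewrite mem_enum !inE => /andP[]; apply: uk.
Qed.

Variables D B : nat -> nat.
Hypotheses (shefferP : sheffer P D B) (eulerianP : eulerian P).
Hypothesis BE : forall n : nat, (1 <= n)%N -> B n = (2 ^ (n - 1))%N.

Lemma rank_bot : rank (\bot : P) = 0.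
Proof.
have := @saturated_bot_rank _ P \bot [::]; apply.
  exact: (rank_function_graded rankP).
by rewrite /saturated /= eqxx.
Qed.

Lemma card_interval_chains (u v : F) : u != \bot -> u <= v ->
  maximal_chains (interval_val u) (interval_val v) #=
  `I_(B (interval_rank v - interval_rank u)).
Proof.
move=> u0 uv; apply: (sheffer_B shefferP); last by rewrite interval_val_le.
by apply: contraNneq u0 => ub; apply/eqP/interval_val_inj.
Qed.

Lemma card_sheffer_chains (v : F) : v != \bot ->
  maximal_chains \bot (interval_val v) #= `I_(D (interval_rank v)).
Proof.
move=> v0; apply: (sheffer_D shefferP).
by apply: contraNneq v0 => vb; apply/eqP/interval_val_inj.
Qed.

(** Here [c] is the number of atoms, or of coatoms, of an interval of length [m]. The bound on [m]
    keeps [m.-1] in the range of the formula for [B]. *)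
Lemma BE_ratio m c : (2 <= m)%N -> B m = (c * B m.-1)%N -> c = 2.
Proof.
case: m => [|[|m]] // _; rewrite !BE //= !subn1 /= expnS => /eqP.
by rewrite eqn_pmul2r ?expn_gt0 // => /eqP.
Qed.

Lemma interval_butterfly_sheffer : butterfly_sheffer interval_rank.
Proof.
split.
- exact: rP.
- exact: rank_bot.
- move=> u v u0 uv ruv; have uv' : u < v by apply: (le_rank_lt uv (r := interval_rank)); lia.
  apply: (@BE_ratio (interval_rank v - interval_rank u)); first by lia.
  apply: card_eq_II_inj (card_interval_chains u0 uv) _; apply: card_interval_up => // z.
  rewrite (coversE rP) => /andP[uz /eqP rz] zv.
  have -> : (interval_rank v - interval_rank u).-1 = (interval_rank v - interval_rank z)%N by lia.
  apply: card_interval_chains => //.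
  by rewrite -lt0x (lt_trans _ uz) // lt0x.
- move=> u v u0 uv ruv; have uv' : u < v by apply: (le_rank_lt uv (r := interval_rank)); lia.
  apply: (@BE_ratio (interval_rank v - interval_rank u)); first by lia.
  apply: card_eq_II_inj (card_interval_chains u0 uv) _; apply: card_interval_low => // z.
  rewrite (coversE rP) => /andP[zv /eqP rz] uz.
  have -> : (interval_rank v - interval_rank u).-1 = (interval_rank z - interval_rank u)%N by lia.
  exact: card_interval_chains.
(* The defining recursion of [mu] on [[\bot, v]], with the Eulerian values substituted, is the
   required alternating sum. *)
- move=> v v0; have [mu [_ mu0] muE] := eulerianP.
  have vb : \bot < interval_val v.
    by rewrite lt0x; apply: contraNneq v0 => vb; apply/eqP/interval_val_inj.
  rewrite -[RHS](mu0 _ _ vb).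
  have -> : [set` `[\bot, interval_val v]] =
      [set` [seq interval_val z | z <- enum F & z <= v]].
    apply/seteqP; split=> x /=; rewrite in_itv /= le0x /=.
      move=> xv; have [w wx] := interval_val_onto (le_trans xv (interval_val_top v)).
      by apply/mapP; exists w; rewrite // mem_filter mem_enum andbT -interval_val_le wx.
    by case/mapP=> w + ->; rewrite mem_filter interval_val_le => /andP[].
  rewrite -fsbig_seq; last first.
    by rewrite (map_inj_uniq interval_val_inj); apply/filter_uniq/enum_uniq.
  rewrite big_map big_filter big_enum_cond /=; apply: eq_bigr => z zv.
  by rewrite muE ?le0x // rank_bot subn0.
Qed.

(** Maximal chains are sorted by the coatom they contain. Rank at least 2 keeps these coatoms away
    from the bottom, where [D] counts their chains. *)
Lemma interval_coatom_function (v : F) : (2 <= interval_rank v)%N ->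
  (#|lower_covers v|%:R = coatom_function D (interval_rank v))%R.
Proof.
move=> rv; have v0 : v != \bot.
  by apply: contraTneq rv => ->; rewrite /interval_rank rank_bot.
have vlt : \bot < v by rewrite lt0x.
have D_low z : covers v z -> maximal_chains \bot (interval_val z) #= `I_(D (interval_rank v).-1).
  rewrite (coversE rP) => /andP[zv /eqP rz]; rewrite rz; apply: card_sheffer_chains.
  by apply: contraTneq rv => zb; rewrite rz zb /interval_rank rank_bot.
have cE : D (interval_rank v) = (#|lower_covers v| * D (interval_rank v).-1)%N.
  apply: card_eq_II_inj (card_sheffer_chains v0) _.
  have -> : #|lower_covers v| = #|[set z in lower_covers v | (\bot <= z)%O]%SET|.
    by apply: eq_card => z; rewrite !inE le0x andbT.
  by apply: (@card_interval_low \bot) => // z zv _; apply: D_low.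
(* The division is legitimate: a lower cover exists, and a maximal chain below it shows that the
   denominator is nonzero. *)
rewrite /coatom_function cE natrM mulfK // pnatr_eq0; apply/eqP => D0.
have [z _] := exists_cov_below rP vlt.
rewrite (cov_rank rP) -(coversE rP) => /D_low; rewrite D0 II0 card_eq0 => /eqP e0.
have [s smax] := exists_maximal_chain (sheffer_locally_finite shefferP \bot (interval_val z)).
by have : (set0 : set (seq P)) s by rewrite -e0.
Qed.

End InitialInterval.

Theorem theorem3p12 (d : Order.disp_t) (P : bPOrderType d) (D B : nat -> nat)
    (shefferP : sheffer P D B) (eulerianP : eulerian P)
    (B0 : B 0 = 1) (BE : forall n : nat, (1 <= n)%N -> B n = (2 ^ (n - 1))%N)
    (n : nat) (n_ge2 : (2 <= n)%N) (y : P) (rank_y : rank y = n) :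
  exists (dQ : Order.disp_t) (Q : finTBPOrderType dQ),
    [/\ graded_interval (\bot : Q) \top, rank (\top : Q) = n &
        order_isomorphic [set` `[\bot, y]]
          (rank_product (with_bottom (with_bottom (butterfly (n - 2)))) Q)] /\
    [/\ forall x : Q, (2 <= rank x <= n - 1)%N -> #|upper_covers x| = 1,
        (3 <= n)%N -> forall x : Q, rank x = 1 -> #|upper_covers x| = 2,
        forall x : Q, ~~ odd (rank x) -> (4 <= rank x <= 2 * (n %/ 2))%N ->
          #|lower_covers x| = 1,
        forall x : Q, odd (rank x) -> (5 <= rank x <= 2 * (n %/ 2) + 1)%N ->
          (#|lower_covers x|%:R = coatom_function D (rank x) / 2)%R &
        forall x : Q, rank x = 3 ->
          exists qs : seq nat,
            [/\ all (leq 2) qs, ((sumn qs)%:R = coatom_function D 3)%R &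
                order_isomorphic [set` `[\bot, x]] [set: polygons qs]]].
Proof.
have rankP := graded_rank_function (sheffer_locally_finite shefferP) (sheffer_graded shefferP).
have /finite_seqP[e eitv] := sheffer_locally_finite shefferP \bot y.
have eE x : (x \in e) = (x <= y).
  have /seteqP[sub1 sub2] := eitv.
  apply/idP/idP => [xe|xy]; first by have := sub2 x xe; rewrite /= in_itv /= le0x.
  by apply: sub1; rewrite /= in_itv /= le0x.
have rS := interval_butterfly_sheffer eE rankP shefferP eulerianP BE.
have cE := interval_coatom_function rankP shefferP (eE := eE).
have rT : interval_rank (\top : initial_interval eE) = n by [].
have rE := @twin_rankE _ _ _ rS.
exists d, (twin_quotient rS); split.
  split; first exact: (rank_function_graded (twin_rank_function rS)) (le0x _).
    by rewrite rE.
  apply: order_isomorphic_trans (interval_isomorphic eE) _.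
  by apply: (twin_factorization rS); rewrite rT; lia.
split=> [x|n3 x|x|x|x]; rewrite rE.
- case/andP=> rx xn; apply: quotient_upper_covers rx _.
  apply: contraTneq xn => ->; rewrite -[twin_rank \top]/(rank y) rank_y.
  lia.
- by apply: quotient_upper_covers_atom; rewrite rT.
- by move=> ev /andP[rx _]; apply: quotient_lower_covers_even.
- move=> _ /andP[rx _]; rewrite -cE; last by apply: leq_trans rx.
  by rewrite quotient_lower_covers 1?ltnW // natrM mulfK // pnatr_eq0.
- move=> rx; have [qs [qs2 sqs iso]] := quotient_polygons rx.
  by exists qs; split=> //; rewrite sqs cE -/(twin_rank x) rx.
Qed.
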